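(* Let $p\ge 7$ be a prime, $h,t\ge1$ and $n\ge 3$ integers, $q=p^h$, and let $B$ be a small minimal blocking set with respect to the hyperplanes of $\mathrm{PG}(n-1,q^t)$ with exponent $e$. Put $q_0=p^e$ and $t_0=ht/e$, so $q^t=q_0^{t_0}$, and let $\mathcal{D}'$ be the Desarguesian $(t_0-1)$-spread of $\mathrm{PG}(nt_0-1,q_0)$. Then the following are equivalent: (i) there exist a $(t_0-2)$-dimensional subspace $\Omega$ of $\mathrm{PG}(nt_0-1,q_0)$, a plane $\Gamma$ skew from $\Omega$ and a blocking set $\bar{B}$ of $\Gamma$ such that $B=\mathcal{B}_{\mathcal{D}'}(K)$, where $K$ is the cone with vertex $\Omega$ and base $\bar{B}$; (ii) $B$ is an $\mathbb{F}_{p^e}$-linear blocking set.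
   Context: Field reduction: each point of $\mathrm{PG}(n-1,q_0^{t_0})$ is a $1$-dimensional $\mathbb{F}_{q_0^{t_0}}$-subspace of $\mathbb{F}_{q_0^{t_0}}^n$, hence a $(t_0-1)$-dimensional subspace of $\mathrm{PG}(nt_0-1,q_0)$; these form the Desarguesian $(t_0-1)$-spread $\mathcal{D}'$. For $U\subseteq\mathrm{PG}(nt_0-1,q_0)$, $\mathcal{B}_{\mathcal{D}'}(U)$ is the set of elements of $\mathcal{D}'$ meeting $U$, identified with points of $\mathrm{PG}(n-1,q^t)$. $B$ is $\mathbb{F}_{p^e}$-linear if $B=\mathcal{B}_{\mathcal{D}'}(\mu)$ for a subspace $\mu$ of $\mathrm{PG}(nt_0-1,q_0)$. The cone with vertex $\Omega$ and base $\bar B$ is $\bigcup_{P\in\bar B}\langle P,\Omega\rangle$; a blocking set of a plane is a point set meeting every line. A blocking set of $\mathrm{PG}(n-1,q^t)$ meets every hyperplane; minimal means no proper subset does; small means fewer than $3(q^t+1)/2$ points. The exponent of such a small minimal blocking set is the largest integer $e$ such that every hyperplane meets $B$ in $1\bmod p^e$ points. *)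

(* Defs.v *)
From HB Require Import structures.
From mathcomp Require Import all_boot all_order all_algebra all_field.
Set Implicit Arguments. Unset Strict Implicit. Unset Printing Implicit Defensive.
Import GRing.Theory.
Local Open Scope ring_scope.

(* Throughout, F is the finite field GF(q^t) and V = F^n ('rV[F]_n).
   A subfield K of F is given as a set of elements; the subfield of order
   p^e is {x | x^(p^e) = x}.  Projective subspaces of PG(n-1, F) resp. of
   PG(nt0-1, F0) (field reduction) are the underlying vector subspaces of V
   over F resp. over F0, given as sets of vectors; vector dimension k over a
   field of order Q is expressed by cardinality Q^k. *)

Section Defs.
Variables (F : finFieldType) (n : nat).
Local Notation V := 'rV[F]_n.

Definition subfield_of (p e : nat) : {set F} := [set x : F | x ^+ (p ^ e) == x].

Definition is_subspace (K : {set F}) (U : {set V}) : bool :=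
  [&& (0 : V) \in U,
      [forall u in U, forall v in U, u + v \in U] &
      [forall a in K, forall u in U, a *: u \in U]].

Definition is_point (K : {set F}) (P : {set V}) : bool :=
  [exists v : V, (v != 0) && (P == [set a *: v | a in K])].

Definition is_hyperplane (H : {set V}) : bool :=
  is_subspace setT H && (#|H| == (#|F| ^ n.-1)%N).

Definition blocking_hyp (B : {set {set V}}) : bool :=
  [forall P in B, is_point setT P] &&
  [forall H : {set V}, is_hyperplane H ==> [exists P in B, P \subset H]].

Definition minimal_blocking_hyp (B : {set {set V}}) : bool :=
  blocking_hyp B &&
  [forall B' : {set {set V}}, (B' \proper B) ==> ~~ blocking_hyp B'].

Definition small_set (B : {set {set V}}) : bool :=
  (2 * #|B| < 3 * (#|F| + 1))%N.

Definition hyp_mod (p : nat) (B : {set {set V}}) (e : nat) : bool :=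
  [forall H : {set V}, is_hyperplane H ==>
     (#|[set P in B | P \subset H]| == 1 %[mod p ^ e])%N].

Definition is_exponent (p : nat) (B : {set {set V}}) (e : nat) : Prop :=
  hyp_mod p B e /\ (forall e', hyp_mod p B e' -> (e' <= e)%N).

(* B_{D'}(U): points of PG(n-1,F) (elements of the Desarguesian spread)
   meeting U (i.e. sharing a nonzero vector with U) *)
Definition B_D (U : {set V}) : {set {set V}} :=
  [set P : {set V} | is_point setT P && [exists v in P, (v != 0) && (v \in U)]].

Definition cone (Omega : {set V}) (Bbar : {set {set V}}) : {set V} :=
  \bigcup_(P in Bbar) [set x + y | x in P, y in Omega].

Definition plane_blocking (K : {set F}) (Q : nat) (Gamma : {set V})
    (Bbar : {set {set V}}) : bool :=
  [forall P in Bbar, is_point K P && (P \subset Gamma)] &&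
  [forall L : {set V},
     [&& is_subspace K L, L \subset Gamma & #|L| == (Q ^ 2)%N] ==>
     [exists P in Bbar, P \subset L]].

Definition is_linear (p e : nat) (B : {set {set V}}) : Prop :=
  exists mu : {set V}, is_subspace (subfield_of p e) mu /\ B = B_D mu.

End Defs.

(* Main.v *)
Require Import Defs.
From HB Require Import structures.
From mathcomp Require Import all_boot all_order all_algebra all_field.
From mathcomp Require Import fingroup mxabelem zify.
Set Implicit Arguments. Unset Strict Implicit. Unset Printing Implicit Defensive.
Import GRing.Theory.
(* Write q = p^e, Q = |F| = q^t0, and W = Omega + Gamma, of size q^2 Q.
   (ii) => (i): a blocking set has more than Q points, so mu has rank at least
   t0 + 1; by minimality the rank may be taken equal to t0 + 1, and mu is then
   the cone over a line L, with vertex a complement Omega of L in mu.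
   (i) => (ii): if the base contains a full line L, the linear set of
   Omega + L blocks all hyperplanes and equals B by minimality.  Otherwise call
   v in W light if the F-point of v meets W in the F0-line of v only.
   If some v of the cone outside Omega is light, then counting the hyperplanes
   through v yields one meeting W in a rank 2 subspace that projects from Omega
   onto a secant of the base; since it has 1 mod q points of B, this secant is
   a full line.  If there is no such v, counting shows that W has no light
   vector at all and that B consists of all points meeting W; since each of
   these meets W in a number of vectors divisible by q^2, all hyperplanes have
   1 mod q^2 points of B, against the maximality of e. *)

(** * Arithmetic estimates for the counting arguments *)

(** The claim is q times the first hypothesis plus the second. It is applied with A =
    [#|S :&: ker f|] and N = [#|W :&: ker f|]; summed over f it contradicts [secant_estimate]. *)
Lemma pointwise_estimate q A N :
  (A + q <= N)%N -> (q ^ 3 <= N)%N -> (q * A + q.+1 * q ^ 2 <= q.+1 * N)%N.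
Proof.
move=> leA leN; have h : (q * (A + q) <= q * N)%N by rewrite leq_mul2l leA orbT.
lia.
Qed.

Lemma light_pointwise_estimate q D N :
  (q <= 1 + D)%N -> (q ^ 2 <= N)%N -> (q ^ 3 <= q ^ 2 * D + N)%N.
Proof.
move=> leD leN; have h : (q ^ 2 * q <= q ^ 2 * (1 + D))%N by rewrite leq_mul2l leD orbT.
lia.
Qed.

(** Here [h] and [l] count the heavy and the light points of B, [z] the light vectors, and [o] is
    the size of the vertex. Since l (q^2 - 1) <= (q + 1)(o - 1), the hypotheses give z <= 2 Q + o -
    q^2 - q - 1, and o <= Q. *)
Lemma light_count_estimate q Q o h l z :
  (7 <= q)%N -> (0 < Q)%N -> (o * q = Q)%N -> (Q < h + l)%N ->
  (h * (q ^ 2).-1 + z <= (q ^ 2 * Q).-1)%N -> (l * q.-1 <= o.-1)%N -> (z <= 3 * Q)%N.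
Proof.
move=> q_ge7 Q0 defQ lt_hl.
have q0 : (0 < q)%N by lia.
have o0 : (0 < o)%N by case: o defQ => // defQ; lia.
have qq0 : (0 < q ^ 2 * Q)%N by rewrite muln_gt0 expn_gt0; lia.
have q20 : (0 < q ^ 2)%N by rewrite expn_gt0; lia.
have h3 : (o * 1 <= o * q)%N by rewrite leq_mul2l; lia.
move: (prednK qq0) (prednK q20) (prednK o0) (prednK q0).
move: (q ^ 2 * Q).-1 (q ^ 2).-1 o.-1 q.-1 => A P o' q' defA defP defo defq le1 le2.
have defP' : P = (q' * q.+1)%N by lia.
have h1 : (Q.+1 * P <= (h + l) * P)%N by rewrite leq_mul2r lt_hl orbT.
have h2 : (l * q' * q.+1 <= o' * q.+1)%N by rewrite leq_mul2r le2 orbT.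
have e1 : (Q.+1 * P + Q.+1 = Q.+1 * q ^ 2)%N by rewrite -defP mulnS addnC.
have e2 : (l * P = l * q' * q.+1)%N by rewrite defP' mulnA.
lia.
Qed.

Section Estimates.
Variables (q Q R : nat).
Hypotheses (q_ge7 : (7 <= q)%N) (le_qQ : (q <= Q)%N) (le_qR : (q <= R)%N).

(** In the coefficient of Q R the right side exceeds the left by 2 q (q - 1) - q (q + 1) = q (q -
    3). The factor 2 matters: a single piece of (q - 1) Q vectors would give a negative
    difference. *)
Lemma secant_estimate sA sN :
  (sA + 2 * (q.-1 * Q) = 2 * (q.-1 * Q) * R)%N ->
  (sN + q ^ 2 * Q + q * R = q * (Q * R) + q ^ 2 * Q * R)%N ->
  (q.+1 * sN < q * sA + q.+1 * q ^ 2 * (Q * R).-1)%N.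
Proof.
have QR0 : (0 < Q * R)%N by rewrite muln_gt0; lia.
move: (prednK QR0); move: (Q * R).-1 => M defM.
have q0 : (0 < q)%N by lia.
move: (prednK q0); move: q.-1 => q' defq E1 E2.
have h1 : (3 * q * Q * R + q * q * Q <= q * q * Q * R + 3 * q * Q)%N.
  have [r ->] : exists r, R = r.+1 by exists R.-1; lia.
  have [s ->] : exists s, q = s + 3 by exists (q - 3); lia.
  nia.
have h2 : (q.+1 * q * q <= q.+1 * q * R)%N by rewrite leq_mul2l le_qR orbT.
have h3 : (0 < q.+1 * q * (Q * q'))%N by rewrite !muln_gt0; lia.
have e1 : (q * sA + 2 * q * (q' * Q) = 2 * q * (q' * Q) * R)%N by lia.
have e2 : (q.+1 * sN + q.+1 * q ^ 2 * Q + q.+1 * q * R =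
           q.+1 * q * (Q * R) + q.+1 * q ^ 2 * Q * R)%N by lia.
have e3 : (q.+1 * q ^ 2 * M + q.+1 * q ^ 2 = q.+1 * q ^ 2 * (Q * R))%N by lia.
subst q.
lia.
Qed.

(** On the left, Q R has coefficient at most 3 q^2 + q^2 + q, which is below q^3 for q >= 7. *)
Lemma light_estimate S sN : (S <= 3 * Q)%N ->
  (sN + q ^ 2 * Q + q * R = q * (Q * R) + q ^ 2 * Q * R)%N ->
  (q ^ 2 * (S * R.-1) + sN < q ^ 3 * (Q * R).-1)%N.
Proof.
have QR0 : (0 < Q * R)%N by rewrite muln_gt0; lia.
move: (prednK QR0); move: (Q * R).-1 => M defM.
have R0 : (0 < R)%N by lia.
move: (prednK R0); move: R.-1 => R' defR leS E.
have h1 : (q ^ 2 * (S * R') <= q ^ 2 * (3 * Q * R'))%N by rewrite leq_mul2l leq_mul2r leS !orbT.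
have h2 : (7 * (q ^ 2 * (Q * R)) <= q * (q ^ 2 * (Q * R)))%N by rewrite leq_mul2r q_ge7 orbT.
have h3 : (q ^ 2 * (1 * q) <= q ^ 2 * (Q * R))%N by rewrite leq_mul2l leq_mul ?orbT //; lia.
have h4 : (q * 1 * (Q * R) <= q * q * (Q * R))%N by rewrite leq_mul2r leq_mul2l; lia.
have h5 : (0 < q ^ 2 * Q)%N by rewrite muln_gt0 expn_gt0; lia.
have e1 : (q ^ 3 * M + q ^ 3 = q ^ 3 * (Q * R))%N by lia.
have e2 : (q ^ 2 * (3 * Q * R') + q ^ 2 * 3 * Q = q ^ 2 * 3 * (Q * R))%N by lia.
lia.
Qed.

(** The leading term of [sN] is (a + q^2) Q R <= 2 a Q R, against a q Q R on the right. *)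
Lemma tangent_estimate a sN : (q ^ 2 <= a)%N ->
  (sN + q ^ 2 * Q + a * R = a * (Q * R) + q ^ 2 * Q * R)%N ->
  (sN < a * q * (Q * R).-1)%N.
Proof.
have QR0 : (0 < Q * R)%N by rewrite muln_gt0; lia.
move: (prednK QR0); move: (Q * R).-1 => M defM lea E.
have h1 : (q ^ 2 * (Q * R) <= a * (Q * R))%N by rewrite leq_mul2r lea orbT.
have h2 : (a * 7 * (Q * R) <= a * q * (Q * R))%N by rewrite leq_mul2r leq_mul2l q_ge7 !orbT.
have h3 : (a * (1 * q) <= a * (Q * R))%N by rewrite leq_mul2l leq_mul ?orbT //; lia.
have h4 : (0 < q ^ 2 * Q)%N by rewrite muln_gt0 expn_gt0; lia.
have e1 : (a * q * M + a * q = a * q * (Q * R))%N by lia.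
lia.
Qed.

End Estimates.

Local Open Scope ring_scope.

(** * The subfield of order p^e *)

Section Subfield.
Variables (F : finFieldType) (p e m : nat).
Hypotheses (p_pr : prime p) (e_gt0 : (0 < e)%N).
Hypothesis (cardF : #|F| = ((p ^ e) ^ m)%N).

Lemma subfield_of_closed : divring_closed (subfield_of F p e).
Proof.
have pcharF : p \in [pchar F] by apply: (@card_finPcharP F p (e * m)); rewrite ?cardF ?expnM.
have pe : [pchar F].-nat (p ^ e)%N.
  rewrite pnatX; apply/orP; left; rewrite pnatE //.
split=> [|a b|a b]; rewrite !inE ?expr1n //.
  (* That (-b)^q = -b follows from b^q + (-b)^q = (b - b)^q = 0, without a case distinction on the
     parity of q. *)
  move=> /eqP aK /eqP bK; rewrite exprDn_pchar // aK (inj_eq (addrI a)) -addr_eq0.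
  by rewrite -{2}bK -exprDn_pchar // addNr expr0n expn_eq0 (gtn_eqF (prime_gt0 p_pr)).
by move=> /eqP aK /eqP bK; rewrite exprMn exprVn aK bK.
Qed.

(** Every element of F is a root of X^|F| - X = (X^q - X) G. As G has at most |F| - q roots, at
    least q elements are roots of X^q - X, and its degree allows no more. *)
Lemma card_subfield_of : #|subfield_of F p e| = (p ^ e)%N.
Proof.
set q := (p ^ e)%N.
have q_gt1 : (1 < q)%N by rewrite -(exp1n e) ltn_exp2r // prime_gt1.
have F_gt1 : (1 < #|F|)%N by apply: finNzRing_gt1.
have sizeX k : (1 < k)%N -> size ('X^k - 'X : {poly F}) = k.+1.
  by move=> k_gt1; rewrite size_polyDl size_polyXn // size_polyN size_polyX ltnS.
have nz k : (1 < k)%N -> ('X^k - 'X : {poly F}) != 0.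
  by move=> k_gt1; rewrite -size_poly_eq0 sizeX.
have [G defG] : exists G : {poly F}, 'X^#|F| - 'X = ('X^q - 'X) * G.
  have /dvdnP[b defb] : (q.-1 %| (#|F|).-1)%N by rewrite cardF dvdn_pred_predX.
  exists (\sum_(i < b) ('X^(q.-1)) ^+ i).
  have XS k : (1 < k)%N -> 'X^k - 'X = 'X * ('X^(k.-1) - 1) :> {poly F}.
    by case: k => [|k] // _; rewrite exprS mulrBr mulr1.
  by rewrite !XS // -mulrA -subrX1 defb mulnC exprM.
have G_nz : G != 0 by apply/eqP=> G0; move: (nz _ F_gt1); rewrite defG G0 mulr0 eqxx.
have sizeG : (size G + q = #|F|.+1)%N.
  by rewrite -(sizeX _ F_gt1) defG size_mul ?nz // sizeX // addnC.
have rootK a : (a \in subfield_of F p e) = root ('X^q - 'X) a.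
  by rewrite inE rootE !hornerE subr_eq0.
apply/eqP; rewrite eqn_leq; apply/andP; split.
  have := max_poly_roots (nz _ q_gt1) _ (enum_uniq (subfield_of F p e)).
  rewrite sizeX // ltnS -cardE; apply.
  by apply/allP=> a; rewrite mem_enum rootK.
have : (#|~: subfield_of F p e| < size G)%N.
  rewrite cardE; apply: (max_poly_roots G_nz _ (enum_uniq _)).
  apply/allP=> a; rewrite mem_enum in_setC rootK => nra.
  have : root ('X^#|F| - 'X) a by rewrite rootE !hornerE expf_card subrr.
  by rewrite defG rootM (negPf nra).
have cC : (#|subfield_of F p e| + #|~: subfield_of F p e| = #|F|)%N by apply: cardsC.
by move=> lt; rewrite -(leq_add2r #|~: subfield_of F p e|) cC -ltnS -sizeG addnC ltn_add2r.
Qed.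

End Subfield.

Definition line_of (F : finFieldType) (n : nat) (K : {set F}) (v : 'rV[F]_n) :=
  [set a *: v | a in K].

Definition setsum (F : finFieldType) (n : nat) (U W : {set 'rV[F]_n}) :=
  [set x + y | x in U, y in W].

(** * Subspaces over a subfield *)

Section Subspaces.
Variables (F : finFieldType) (n : nat) (K : {set F}).
Hypothesis K_field : divring_closed K.
Local Notation V := 'rV[F]_n.
Implicit Types (U W X A : {set V}) (v w : V).

Lemma is_subspaceP U :
  reflect [/\ 0 \in U, {in U &, forall u v, u + v \in U} &
            {in K & U, forall a u, a *: u \in U}] (is_subspace K U).
Proof.
apply: (iffP and3P) => [[U0 /forall_inP UD /forall_inP UZ]|[U0 UD UZ]]; split=> //.
- by move=> u v /UD /forall_inP; apply.
- by move=> a u /UZ /forall_inP; apply.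
- by apply/forall_inP=> u uU; apply/forall_inP=> v; apply: UD.
- by apply/forall_inP=> a aK; apply/forall_inP=> v; apply: UZ.
Qed.

Lemma subfield0 : 0 \in K.
Proof. by case: K_field => K1 KB _; rewrite -(subrr 1) KB. Qed.
Lemma subfield1 : 1 \in K.
Proof. by case: K_field. Qed.
Lemma subfieldB a b : a \in K -> b \in K -> a - b \in K.
Proof. by case: K_field => _ KB _; apply: KB. Qed.
Lemma subfieldN a : a \in K -> - a \in K.
Proof. by move=> aK; rewrite -sub0r subfieldB // subfield0. Qed.
Lemma subfieldD a b : a \in K -> b \in K -> a + b \in K.
Proof. by move=> aK bK; rewrite -(opprK b) subfieldB // subfieldN. Qed.
Lemma subfieldV a : a \in K -> a^-1 \in K.
Proof. by case: K_field => K1 _ KV aK; rewrite -div1r KV. Qed.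
Lemma subfieldM a b : a \in K -> b \in K -> a * b \in K.
Proof. by case: K_field => _ _ KV aK bK; rewrite -(invrK b) KV // subfieldV. Qed.

Lemma subspace0 U : is_subspace K U -> 0 \in U.
Proof. by case/is_subspaceP. Qed.
Lemma subspaceD U u v : is_subspace K U -> u \in U -> v \in U -> u + v \in U.
Proof. by case/is_subspaceP=> _ UD _; apply: UD. Qed.
Lemma subspaceZ U a u : is_subspace K U -> a \in K -> u \in U -> a *: u \in U.
Proof. by case/is_subspaceP=> _ _ UZ; apply: UZ. Qed.
Lemma subspaceN U u : is_subspace K U -> u \in U -> - u \in U.
Proof. by move=> sU uU; rewrite -scaleN1r (subspaceZ sU) // subfieldN ?subfield1. Qed.
Lemma subspaceB U u v : is_subspace K U -> u \in U -> v \in U -> u - v \in U.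
Proof. by move=> sU uU vU; rewrite (subspaceD sU) // (subspaceN sU). Qed.
Lemma subspaceDr U u v : is_subspace K U -> v \in U -> (u + v \in U) = (u \in U).
Proof.
move=> sU vU; apply/idP/idP=> uU; last exact: (subspaceD sU).
by rewrite -(addrK v u) (subspaceB sU).
Qed.
Lemma subspaceZE U a u : is_subspace K U -> a \in K -> a != 0 -> (a *: u \in U) = (u \in U).
Proof.
move=> sU aK a0; apply/idP/idP=> uU; last exact: (subspaceZ sU).
by rewrite -(scale1r u) -(mulVf a0) -scalerA (subspaceZ sU) // subfieldV.
Qed.

Lemma subspaceT : is_subspace K [set: V].
Proof. by apply/is_subspaceP; split=> [|u v _ _|a u _ _]; rewrite in_setT. Qed.

Lemma subspace_0 : is_subspace K [set 0 : V].
Proof.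
apply/is_subspaceP; split; first by rewrite inE.
- by move=> u v /set1P-> /set1P->; rewrite addr0 inE.
- by move=> a u _ /set1P->; rewrite scaler0 inE.
Qed.

Lemma subspaceI U W : is_subspace K U -> is_subspace K W -> is_subspace K (U :&: W).
Proof.
move=> sU sW; apply/is_subspaceP; split; first by rewrite inE !subspace0.
- by move=> u v; rewrite !inE => /andP[? ?] /andP[? ?]; rewrite !subspaceD.
- by move=> a u aK; rewrite !inE => /andP[? ?]; rewrite !subspaceZ.
Qed.

Lemma subspace_line v : is_subspace K (line_of K v).
Proof.
apply/is_subspaceP; split.
- by apply/imsetP; exists 0; rewrite ?subfield0 ?scale0r.
- move=> _ _ /imsetP[a aK ->] /imsetP[b bK ->].
  by apply/imsetP; exists (a + b); rewrite ?subfieldD ?scalerDl.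
- move=> a _ aK /imsetP[b bK ->].
  by apply/imsetP; exists (a * b); rewrite ?subfieldM ?scalerA.
Qed.

Lemma mem_line v : v \in line_of K v.
Proof. by apply/imsetP; exists 1; rewrite ?subfield1 ?scale1r. Qed.

Lemma sub_line U v : is_subspace K U -> v \in U -> line_of K v \subset U.
Proof. by move=> sU vU; apply/subsetP=> _ /imsetP[a aK ->]; apply: (subspaceZ sU). Qed.

Lemma card_line v : v != 0 -> #|line_of K v| = #|K|.
Proof.
move=> v0; rewrite card_in_imset // => a b _ _ /eqP.
by rewrite -subr_eq0 -scalerBl scaler_eq0 (negPf v0) orbF subr_eq0 => /eqP.
Qed.

Lemma subspace_setsum U W : is_subspace K U -> is_subspace K W -> is_subspace K (setsum U W).
Proof.
move=> sU sW; apply/is_subspaceP; split.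
- by apply/imset2P; exists 0 0; rewrite ?subspace0 ?addr0.
- move=> _ _ /imset2P[x y xU yW ->] /imset2P[x' y' xU' yW' ->].
  by apply/imset2P; exists (x + x') (y + y'); rewrite ?subspaceD // addrACA.
- move=> a _ aK /imset2P[x y xU yW ->].
  by apply/imset2P; exists (a *: x) (a *: y); rewrite ?subspaceZ // scalerDr.
Qed.

Lemma setsum_subl U W : is_subspace K W -> U \subset setsum U W.
Proof.
move=> sW; apply/subsetP=> u uU.
by apply/imset2P; exists u 0; rewrite ?addr0 ?subspace0.
Qed.

Lemma setsum_subr U W : is_subspace K U -> W \subset setsum U W.
Proof.
move=> sU; apply/subsetP=> w wW.
by apply/imset2P; exists 0 w; rewrite ?add0r ?subspace0.
Qed.

Lemma setsum_sub U W X : is_subspace K X -> U \subset X -> W \subset X -> setsum U W \subset X.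
Proof.
move=> sX /subsetP UX /subsetP WX; apply/subsetP=> _ /imset2P[x y /UX xX /WX yX ->].
exact: (subspaceD sX).
Qed.

Lemma card_setsum U W : is_subspace K U -> is_subspace K W -> U :&: W \subset [set 0] ->
  #|setsum U W| = (#|U| * #|W|)%N.
Proof.
move=> sU sW UW0; rewrite /setsum -cardsX.
have -> : [set x + y | x in U, y in W] = [set u.1 + u.2 | u in setX U W].
  apply/setP=> z; apply/imset2P/imsetP=> [[x y xU yW ->]|[[x y] /setXP[/= xU yW] ->]].
    by exists (x, y); rewrite ?inE ?xU.
  by exists x y.
rewrite card_in_imset // => -[x y] [x' y'] /setXP[/= xU yW] /setXP[/= xU' yW'].
move=> /(congr1 (fun z => z - x - y')); rewrite [x + y]addrC addrK addrAC addrK => E.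
have : y - y' \in [set 0 : V].
  by apply: (subsetP UW0); rewrite inE (subspaceB sW) // andbT E (subspaceB sU).
move=> /set1P y0; move: E; rewrite y0 => /esym/eqP; rewrite subr_eq0 => /eqP ->.
by move/eqP: y0; rewrite subr_eq0 => /eqP ->.
Qed.

(** Grassmann's formula through cardinalities: if the intersection were trivial, addition would
    embed the product of U and W into X. *)
Lemma meet_nontriv U W X : is_subspace K U -> is_subspace K W -> is_subspace K X ->
  U \subset X -> W \subset X -> (#|X| < #|U| * #|W|)%N ->
  exists x, [/\ x != 0, x \in U & x \in W].
Proof.
move=> sU sW sX UX WX lt.
case: (boolP (U :&: W \subset [set 0])) => [UW0|/subsetPn[x]].
  move: lt; rewrite -card_setsum // ltnNge subset_leq_card //; exact: setsum_sub.
by rewrite !inE => /andP[xU xW] x0; exists x.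
Qed.

Lemma line_meet U v : is_subspace K U -> v \notin U -> U :&: line_of K v \subset [set 0].
Proof.
move=> sU vU; apply/subsetP=> x /setIP[xU /imsetP[a aK E]]; move: xU; rewrite E inE.
have [->|a0] := eqVneq a 0; first by rewrite scale0r.
by rewrite (subspaceZE v sU) // (negPf vU).
Qed.

Lemma card_adjoin U v : is_subspace K U -> v \notin U ->
  #|setsum U (line_of K v)| = (#|U| * #|K|)%N.
Proof.
move=> sU vU; rewrite card_setsum ?subspace_line ?line_meet // card_line //.
by apply: contraNneq vU => ->; apply: subspace0.
Qed.

Lemma adjoin_sub U W v : is_subspace K W -> U \subset W -> v \in W ->
  setsum U (line_of K v) \subset W.
Proof. by move=> sW UW vW; rewrite setsum_sub // sub_line. Qed.

Lemma mem_adjoin U v : is_subspace K U -> v \in setsum U (line_of K v).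
Proof. by move=> sU; rewrite (subsetP (setsum_subr _ _)) // mem_line. Qed.

Lemma card_lt_subspace A U v : is_subspace K A -> is_subspace K U -> A \subset U -> v \in U ->
  v \notin A -> (#|A| * #|K| <= #|U|)%N.
Proof.
by move=> sA sU AU vU vA; rewrite -(card_adjoin sA vA) subset_leq_card // adjoin_sub.
Qed.

Lemma card_subfield_gt1 : (1 < #|K|)%N.
Proof.
have: (#|[set (0%R : F); 1%R]| <= #|K|)%N; last by rewrite cards2 eq_sym oner_neq0.
by apply: subset_leq_card; apply/subsetP=> x /set2P[] ->; rewrite ?subfield0 ?subfield1.
Qed.

(** Vectors of U are adjoined to A one at a time, each multiplying the cardinality by |K|; the
    exponent takes the place of a dimension. *)
Lemma card_overspace i A U : is_subspace K A -> is_subspace K U -> A \subset U ->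
  #|A| = (#|K| ^ i)%N -> exists2 k, #|U| = (#|K| ^ k)%N & (i <= k)%N.
Proof.
have [d le_d] := ubnP (#|U| - #|A|); elim: d => // d IHd in i A le_d *.
move=> sA sU AU cA.
have [UA|/subsetPn[v vU vA]] := boolP (U \subset A).
  by exists i => //; rewrite -cA; apply: eq_card; apply/subset_eqP/andP.
have [|||||k Uk ik] := IHd i.+1 (setsum A (line_of K v)).
- have := card_lt_subspace sA sU AU vU vA; rewrite card_adjoin //.
  have := card_subfield_gt1; have : (0 < #|A|)%N by rewrite cA expn_gt0 ltnW ?card_subfield_gt1.
  nia.
- by rewrite subspace_setsum ?subspace_line.
- by [].
- exact: adjoin_sub.
- by rewrite card_adjoin // cA expnSr.
by exists k => //; apply: ltnW.
Qed.

Lemma card_subspace U : is_subspace K U -> exists k, #|U| = (#|K| ^ k)%N.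
Proof.
move=> sU; have [] := @card_overspace 0 [set 0] U; rewrite ?subspace_0 ?cards1 //.
  by rewrite sub1set subspace0.
by move=> k; exists k.
Qed.

Lemma intermediate_subspace d A U : is_subspace K A -> is_subspace K U -> A \subset U ->
  (#|A| * #|K| ^ d <= #|U|)%N ->
  exists W, [/\ is_subspace K W, A \subset W, W \subset U & #|W| = (#|A| * #|K| ^ d)%N].
Proof.
have Kgt1 := card_subfield_gt1.
elim: d => [|d IHd] in A *; first by exists A; rewrite muln1.
move=> sA sU AU le.
have [UA|/subsetPn[v vU vA]] := boolP (U \subset A).
  have A0 : (0 < #|A|)%N by apply/card_gt0P; exists 0; apply: subspace0.
  suff : (#|U| < #|U|)%N by rewrite ltnn.
  apply: leq_ltn_trans (subset_leq_card UA) (leq_trans _ le).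
  by rewrite ltn_Pmulr // expnS (leq_trans Kgt1) // leq_pmulr // expn_gt0 ltnW.
have [||||W [sW AW WU cW]] := IHd (setsum A (line_of K v)) => //.
- by rewrite subspace_setsum ?subspace_line.
- exact: adjoin_sub.
- by rewrite card_adjoin // -mulnA -expnS.
exists W; split=> //; last by rewrite cW card_adjoin // expnS mulnA.
exact: subset_trans (setsum_subl _ (subspace_line v)) AW.
Qed.

End Subspaces.

(** * Points, hyperplanes and blocking sets *)

Section Points.
Variables (F : finFieldType) (n : nat).
Local Notation V := 'rV[F]_n.
Implicit Types (v w : V) (U H P : {set V}) (B : {set {set V}}).

Definition point v := line_of setT v.

Lemma setT_closed : divring_closed [set: F].
Proof. by split=> [|a b|a b]; rewrite !in_setT. Qed.

Lemma subspace_restrict (K : {set F}) U : is_subspace setT U -> is_subspace K U.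
Proof.
case/is_subspaceP=> U0 UD UZ; apply/is_subspaceP; split=> // a u _ uU.
by rewrite UZ ?in_setT.
Qed.

Lemma is_pointP P : reflect (exists2 v, v != 0 & P = point v) (is_point setT P).
Proof.
apply: (iffP existsP) => [[v /andP[v0 /eqP ->]]|[v v0 ->]]; first by exists v.
by exists v; rewrite v0 eqxx.
Qed.

Lemma mem_point v : v \in point v.
Proof. exact: mem_line setT_closed v. Qed.

Lemma subspace_point v : is_subspace setT (point v).
Proof. exact: subspace_line setT_closed v. Qed.

Lemma point_sub U v : is_subspace setT U -> (point v \subset U) = (v \in U).
Proof.
move=> sU; apply/idP/idP=> [/subsetP|vU]; first by apply; apply: mem_point.
exact: sub_line sU vU.
Qed.

Lemma point_sym v w : v != 0 -> (v \in point w) -> (w \in point v).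
Proof.
move=> v0 /imsetP[a _ E]; have a0 : a != 0 by apply: contraNneq v0 => a0; rewrite E a0 scale0r.
by apply/imsetP; exists a^-1; rewrite ?in_setT // E scalerA mulVf // scale1r.
Qed.

Lemma eq_point v w : v != 0 -> v \in point w -> point v = point w.
Proof.
move=> v0 vw; apply/eqP; rewrite eqEsubset !point_sub ?subspace_point //.
by rewrite vw point_sym.
Qed.

Lemma B_DP U P :
  reflect (exists v, [/\ v != 0, v \in U & P = point v]) (P \in B_D U).
Proof.
rewrite inE; apply: (iffP andP) => [[/is_pointP[w w0 ->] /exists_inP[v vw /andP[v0 vU]]]|].
  by exists v; rewrite (eq_point v0 vw).
move=> [v [v0 vU ->]]; split; first by apply/is_pointP; exists v.
by apply/exists_inP; exists v; rewrite ?mem_point ?v0.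
Qed.

Lemma hyperplane_subspace H : is_hyperplane H -> is_subspace setT H.
Proof. by case/andP. Qed.

Lemma blocking_point B P : blocking_hyp B -> P \in B -> exists2 v, v != 0 & P = point v.
Proof. by case/andP=> /forall_inP pB _ /pB /is_pointP. Qed.

Lemma blocking_meet B H : blocking_hyp B -> is_hyperplane H -> exists2 P, P \in B & P \subset H.
Proof. by case/andP=> _ /forallP hB hH; apply/exists_inP; apply: implyP (hB H) hH. Qed.

(** The form in which minimality enters both implications: a linear set inside B is shown to block,
    hence exhausts B. *)
Lemma minimal_blocking_eq B B' :
  minimal_blocking_hyp B -> blocking_hyp B' -> B' \subset B -> B = B'.
Proof.
case/andP=> _ /forallP mB bB' sB; apply/eqP; rewrite eqEsubset sB andbT.
apply: contraTT bB' => nsub; apply: implyP (mB B') _.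
by rewrite properE sB nsub.
Qed.

Lemma meet_hyperplane (K : {set F}) U H : divring_closed K -> is_subspace K U ->
  (#|F| < #|U|)%N -> (0 < n)%N -> is_hyperplane H -> exists v, [/\ v != 0, v \in U & v \in H].
Proof.
move=> K_field sU ltU n0 /andP[sH /eqP cH].
apply: (meet_nontriv K_field sU (subspace_restrict K sH) (subspaceT n K)); rewrite ?subsetT //.
rewrite cardsT card_mx mul1n cH -[in X in (X < _)%N](prednK n0) expnS ltn_mul2r ltU andbT.
by rewrite expn_gt0 ltnW // finNzRing_gt1.
Qed.

Lemma blocking_B_D (K : {set F}) U : divring_closed K -> is_subspace K U ->
  (#|F| < #|U|)%N -> (0 < n)%N -> blocking_hyp (B_D U).
Proof.
move=> K_field sU ltU n0; apply/andP; split.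
  by apply/forall_inP=> P; rewrite inE => /andP[].
apply/forallP=> H; apply/implyP=> hH.
have [v [v0 vU vH]] := meet_hyperplane K_field sU ltU n0 hH.
apply/exists_inP; exists (point v); last by rewrite point_sub ?hyperplane_subspace.
by apply/B_DP; exists v.
Qed.

End Points.

(** * Linear forms, hyperplanes and double counting *)

Section Orthogonality.
Variables (F : finFieldType) (n : nat).
Local Notation V := 'rV[F]_n.
Implicit Types (f v w : V) (S : {set V}).

(** Row vectors double as linear forms through the standard bilinear form. Counts over hyperplanes
    become sums over nonzero f, in which proportional forms are all counted. *)
Definition orth f v := v *m f^T == 0.
Definition ker f := [set v | orth f v].

Lemma orthC f v : orth f v = orth v f.
Proof. by rewrite /orth -(inj_eq trmx_inj) trmx_mul trmxK trmx0. Qed.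

Lemma card_annihilator m (A : 'M[F]_(m, n)) :
  #|[set f : V | A *m f^T == 0]| = (#|F| ^ (n - \rank A))%N.
Proof.
rewrite -mxrank_tr -mxrank_ker -card_rowg; apply: eq_card => f.
rewrite mem_rowg inE -(inj_eq trmx_inj) trmx_mul trmxK trmx0.
by apply/eqP/sub_kermxP.
Qed.

Lemma card_orth v : v != 0 -> #|[set f | orth f v]| = (#|F| ^ (n - 1))%N.
Proof. by move=> v0; rewrite card_annihilator rank_rV v0. Qed.

Lemma card_ker f : f != 0 -> #|ker f| = (#|F| ^ (n - 1))%N.
Proof. by move=> f0; rewrite -(card_orth f0); apply: eq_card => v; rewrite !inE orthC. Qed.

Lemma card_orth2 v w : v != 0 -> w \notin point v ->
  #|[set f | orth f v && orth f w]| = (#|F| ^ (n - 2))%N.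
Proof.
move=> v0 wv.
have rk2 : \rank (col_mx v w) = 2%N.
  apply/eqP; rewrite eqn_leq rank_leq_row -addsmxE.
  have vlt : (v < v + w)%MS.
    rewrite /ltmx addsmxSl /=; apply: contra wv => le.
    have /sub_rVP[a ->] := submx_trans (addsmxSr v w) le.
    by apply/imsetP; exists a; rewrite ?in_setT.
  by have := rank_ltmx vlt; rewrite rank_rV v0.
rewrite -rk2 -card_annihilator; apply: eq_card => f; rewrite !inE mul_col_mx.
by rewrite col_mx_eq0.
Qed.

Lemma ker_hyperplane f : f != 0 -> is_hyperplane (ker f).
Proof.
move=> f0; rewrite /is_hyperplane card_ker // subn1 eqxx andbT.
apply/is_subspaceP; split=> [|u v|a u _]; rewrite ?inE /orth ?mul0mx //.
  by move=> /eqP u0 /eqP v0; rewrite mulmxDl u0 v0 addr0.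
by move=> /eqP u0; rewrite -scalemxAl u0 scaler0.
Qed.

Lemma ker_subspace (K : {set F}) f : f != 0 -> is_subspace K (ker f).
Proof. by move=> f0; apply: subspace_restrict; case/andP: (ker_hyperplane f0). Qed.

Lemma card_orth_neq0 v : v != 0 ->
  #|[set f | (f != 0) && orth f v]| = (#|F| ^ (n - 1)).-1.
Proof.
move=> v0; rewrite -(card_orth v0) [in RHS](cardsD1 0) inE /orth trmx0 mulmx0 eqxx.
by apply: eq_card => f; rewrite !inE.
Qed.

(** Double counting of pairs (f, w) with w in S and f vanishing at v and w. A multiple w of v
    imposes no further condition on f, any other w one more; the summand [#|S|] on the left is the
    term f = 0. *)
Lemma sum_orth S v : v != 0 ->
  (\sum_(f : V | (f != 0%R) && orth f v) #|S :&: ker f| + #|S| =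
   #|S :&: point v| * #|F| ^ (n - 1) + #|S :\: point v| * #|F| ^ (n - 2))%N.
Proof.
move=> v0; transitivity (\sum_(f | orth f v) #|S :&: ker f|)%N.
  rewrite [RHS](bigD1 0) /=; last by rewrite /orth trmx0 mulmx0.
  rewrite addnC; congr (_ + _)%N; last by apply: eq_bigl => f; rewrite andbC.
  by apply: eq_card => u; rewrite !inE /orth trmx0 mulmx0 eqxx andbT.
transitivity (\sum_(w in S) #|[set f | orth f v && orth f w]|)%N.
  under eq_bigr do rewrite -sum1_card.
  under [RHS]eq_bigr do rewrite -sum1_card.
  rewrite (exchange_big_dep (mem S)) /=; last by move=> f w _; rewrite inE => /andP[].
  apply: eq_bigr => w wS; apply: eq_bigl => f; rewrite !inE.
  by case: (w \in S) wS => //=; rewrite andbC.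
rewrite -!sum_nat_const (big_setID (point v)) /=; congr (_ + _)%N; apply: eq_bigr => w.
  move=> /setIP[_ /imsetP[a _ ->]]; rewrite -(card_orth v0); apply: eq_card => f.
  rewrite !inE /orth; case: eqP => //= v1; by rewrite -scalemxAl v1 scaler0 eqxx.
by move=> /setDP[_ wv]; rewrite card_orth2.
Qed.

(** The Q^n - 1 nonzero forms must each vanish at some point of B, and a point is annihilated by
    only Q^(n-1) - 1 of them; Q points would not suffice. *)
Lemma card_blocking (B : {set {set V}}) : (0 < n)%N -> blocking_hyp B -> (#|F| < #|B|)%N.
Proof.
move=> n0 bB; set Q := #|F|; have Q1 : (1 < Q)%N by apply: finNzRing_gt1.
have le : (Q ^ n - 1 <= #|B| * (Q ^ (n - 1)).-1)%N.
  have -> : (Q ^ n - 1 = \sum_(f : V | f != 0%R) 1)%N.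
    have := cardC1 (0 : V); rewrite card_mx mul1n -sum1_card subn1 => <-.
    exact: eq_bigl.
  rewrite -sum_nat_const.
  apply: (@leq_trans (\sum_(f : V | f != 0%R) \sum_(P in B | P \subset ker f) 1)%N).
    apply: leq_sum => f f0; have [P PB Pf] := blocking_meet bB (ker_hyperplane f0).
    by rewrite (bigD1 P) ?PB.
  rewrite (exchange_big_dep (mem B)) /=; last by move=> f P _ /andP[].
  apply: leq_sum => P PB; have [v v0 defP] := blocking_point bB PB.
  rewrite -(card_orth_neq0 v0) -sum1_card; apply: eq_leq; apply: eq_bigl => f.
  rewrite !inE PB /=; case: eqP => //= /eqP f0.
  by rewrite defP point_sub ?inE //; case/andP: (ker_hyperplane f0).
have QR : (Q ^ n = Q * Q ^ (n - 1))%N by rewrite -expnS subn1 prednK.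
have : (0 < Q ^ (n - 1))%N by rewrite expn_gt0 ltnW.
move: le; rewrite QR; set R := (Q ^ (n - 1))%N => le R0.
rewrite ltnNge; apply/negP=> leB; nia.
Qed.

Lemma sum_orth_const v m : v != 0 ->
  (\sum_(f : V | (f != 0%R) && orth f v) m = m * (#|F| ^ (n - 1)).-1)%N.
Proof.
move=> v0; rewrite mulnC -(card_orth_neq0 v0) -sum_nat_const.
by apply: eq_bigl => f; rewrite inE.
Qed.

End Orthogonality.

Section HyperplaneSection.
Variables (F : finFieldType) (n : nat) (K : {set F}).
Hypothesis n_gt0 : (0 < n)%N.
Local Notation V := 'rV[F]_n.

Lemma subspace_group_set (U : {set V}) : is_subspace K U -> group_set U.
Proof.
move=> sU; apply/group_setP; split=> [|u v]; first exact: subspace0 sU.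
exact: (subspaceD sU).
Qed.

(** The product formula for the additive groups U and H, whose sum has at most |F|^n elements. *)
Lemma card_subspaceI_hyperplane (U H : {set V}) : is_subspace K U -> is_hyperplane H ->
  (#|U| <= #|U :&: H| * #|F|)%N.
Proof.
move=> sU /andP[sH /eqP cH].
have := mul_cardG (Group (subspace_group_set sU))
  (Group (subspace_group_set (subspace_restrict K sH))).
rewrite /= cH => eqUH; have F0 : (0 < #|F| ^ n.-1)%N by rewrite expn_gt0 ltnW // finNzRing_gt1.
rewrite -(leq_pmul2r F0) eqUH mulnC -mulnA leq_mul2l -expnS prednK //.
by rewrite (leq_trans (max_card _)) ?orbT // card_mx mul1n.
Qed.

End HyperplaneSection.

(** * Linear blocking sets are cones *)

Section LinearToCone.
Variables (F : finFieldType) (n t0 : nat) (K : {set F}).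
Hypotheses (K_field : divring_closed K) (n_ge3 : (3 <= n)%N) (t0_gt0 : (0 < t0)%N).
Hypothesis (cardF : #|F| = (#|K| ^ t0)%N).
Local Notation V := 'rV[F]_n.
Implicit Types (B : {set {set V}}) (U : {set V}).

(** Otherwise U has at most Q = |F| vectors, hence [B_D U] at most Q points, too few by
    [card_blocking]. *)
Lemma card_linear_blocking U : is_subspace K U -> blocking_hyp (B_D U) ->
  (#|K| ^ t0.+1 <= #|U|)%N.
Proof.
move=> sU bU; have [k cU] := card_subspace K_field sU.
rewrite cU leq_exp2l ?card_subfield_gt1 // ltnNge; apply/negP=> le_k.
have : (#|B_D U| <= #|U|)%N.
  apply: leq_trans (leq_imset_card (@point F n) (mem U)); apply: subset_leq_card.
  by apply/subsetP=> P /B_DP[v [_ vU ->]]; apply: imset_f.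
rewrite leqNgt => /negP; apply.
apply: leq_ltn_trans (card_blocking _ bU); last exact: ltnW (ltnW _).
by rewrite cU cardF leq_exp2l ?card_subfield_gt1.
Qed.

Lemma cone_of_linear B U : minimal_blocking_hyp B -> is_subspace K U -> B = B_D U ->
  exists (Omega Gamma : {set V}) (Bbar : {set {set V}}),
    is_subspace K Omega /\ #|Omega| = (#|K| ^ (t0 - 1))%N /\
    is_subspace K Gamma /\ #|Gamma| = (#|K| ^ 3)%N /\
    Omega :&: Gamma = [set 0] /\
    plane_blocking K #|K| Gamma Bbar /\ B = B_D (cone Omega Bbar).
Proof.
move=> mB sU defB; have bB : blocking_hyp B by case/andP: mB.
have K1 := card_subfield_gt1 K_field; set q := #|K| in K1 *.
have cU : (q ^ t0.+1 <= #|U|)%N by apply: card_linear_blocking; rewrite -?defB.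
have s0 := subspace_0 n K.
(* M has rank t0 + 1, enough to block; at the end minimality gives B = [B_D M]. *)
have [||||M [sM _ MU cM]] := @intermediate_subspace F n K K_field t0.+1 [set 0] U => //.
- by rewrite sub1set (subspace0 sU).
- by rewrite cards1 mul1n.
rewrite cards1 mul1n -/q in cM.
have [||||O [sO _ OM cO]] := @intermediate_subspace F n K K_field (t0 - 1) [set 0] M => //.
- by rewrite sub1set (subspace0 sM).
- by rewrite cards1 mul1n cM leq_exp2l // leq_subLR ltnW.
rewrite cards1 mul1n -/q in cO.
have qt : (q ^ t0 = q ^ (t0 - 1) * q)%N by rewrite subn1 -expnSr prednK.
have qt_gt0 : (0 < q ^ (t0 - 1))%N by rewrite expn_gt0 ltnW.
have [v1 v1M v1O] : exists2 v, v \in M & v \notin O.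
  apply/subsetPn; apply/negP=> /subset_leq_card.
  rewrite cM cO expnS qt mulnC leqNgt => /negP; apply.
  by rewrite -mulnA ltn_Pmulr // (leq_trans K1) // leq_pmulr // ltnW.
have sl (v : V) : is_subspace K (line_of K v) := subspace_line K_field v.
set O1 := setsum O (line_of K v1).
have sO1 : is_subspace K O1 by apply: subspace_setsum.
have cO1 : #|O1| = (q ^ t0)%N by rewrite qt card_adjoin // cO.
have O1M : O1 \subset M by apply: adjoin_sub.
have [v2 v2M v2O] : exists2 v, v \in M & v \notin O1.
  apply/subsetPn; apply/negP=> /subset_leq_card; rewrite cM cO1 expnS leqNgt => /negP; apply.
  by rewrite ltn_Pmull // expn_gt0 ltnW.
have defM : M = setsum O1 (line_of K v2).
  apply/eqP; rewrite eq_sym eqEcard adjoin_sub //= card_adjoin // cO1 cM.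
  by rewrite expnSr.
(* V has rank n t0 >= 3 t0 > t0 + 1 over K, so M is not all of V. The vector v3 completes L to a
   plane skew from O. *)
have [v3 _ v3M] : exists2 v, v \in [set: V] & v \notin M.
  apply/subsetPn; apply/negP=> /subset_leq_card; rewrite cM cardsT card_mx mul1n cardF -expnM.
  rewrite leq_exp2l // leqNgt => /negP; apply.
  apply: (@leq_trans (t0 * 3)); last by rewrite leq_mul2l n_ge3 orbT.
  by rewrite -addn2 mulnS leq_add2l leq_pmull.
set L := setsum (line_of K v1) (line_of K v2).
have sL : is_subspace K L by apply: subspace_setsum.
have LM : L \subset M.
  by rewrite (setsum_sub sM) // sub_line // (subsetP O1M) // mem_adjoin.
have v1nz : v1 != 0 by apply: contraNneq v1O => ->; apply: subspace0 sO.
have cL : #|L| = (q ^ 2)%N.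
  rewrite card_adjoin ?card_line //.
  by apply: contra v2O; apply: subsetP (setsum_subr _ sO) _.
set G := setsum L (line_of K v3).
have sG : is_subspace K G by apply: subspace_setsum.
have LG : L \subset G by apply: setsum_subl.
have cG : #|G| = (q ^ 3)%N.
  by rewrite card_adjoin // ?cL -?expnSr //; apply: contra v3M; apply: subsetP.
have OG : O :&: G = [set 0].
  apply/eqP; rewrite eqEsubset sub1set inE (subspace0 sO) (subspace0 sG) !andbT.
  apply/subsetP=> x /setIP[xO /imset2P[l _ lL /imsetP[c cK ->] E]].
  have xM : x \in M := subsetP OM x xO; have lM : l \in M := subsetP LM l lL.
  have c0 : c = 0.
    apply/eqP; apply: contraNT v3M => c0; rewrite -(subspaceZE K_field v3 sM cK c0).
    by rewrite -(subspaceDr K_field _ sM lM) addrC -E.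
  move: E; rewrite c0 scale0r addr0 => E; move: lL; rewrite -E.
  case/imset2P=> _ _ /imsetP[a aK ->] /imsetP[b bK ->] {}E.
  have av1 : a *: v1 \in O1.
    by apply: (subsetP (setsum_subr _ sO)); apply/imsetP; exists a.
  have b0 : b = 0.
    apply/eqP; apply: contraNT v2O => b0; rewrite -(subspaceZE K_field v2 sO1 bK b0).
    rewrite -(subspaceDr K_field _ sO1 av1) addrC -E.
    by rewrite (subsetP (setsum_subl O (sl v1))).
  move: E; rewrite b0 scale0r addr0 => E; rewrite inE E.
  have [->|a0] := eqVneq a 0; first by rewrite scale0r.
  by case/negP: v1O; rewrite -(subspaceZE K_field v1 sO aK a0) -E.
exists O, G, [set line_of K v | v in L :\ 0]; do 5!split=> //.
split.
  apply/andP; split.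
    apply/forall_inP=> _ /imsetP[v /setD1P[v0 vL] ->]; apply/andP; split.
      by apply/existsP; exists v; rewrite v0 eqxx.
    by apply: subset_trans LG; apply: sub_line.
  (* The points of L block the plane: two subspaces of rank 2 inside rank 3 meet, as q^3 < q^4. *)
  apply/forallP=> L'; apply/implyP=> /and3P[sL' L'G /eqP cL'].
  have [|||v [v0 vL vL']] := meet_nontriv K_field sL sL' sG => //.
    by rewrite cG cL cL' -expnD ltn_exp2l.
  apply/exists_inP; exists (line_of K v); last exact: sub_line.
  by apply/imsetP; exists v => //; apply/setD1P.
have -> : cone O [set line_of K v | v in L :\ 0] = M.
  apply/eqP; rewrite eqEsubset; apply/andP; split.
    apply/bigcupsP=> _ /imsetP[v /setD1P[v0 vL] ->]; apply: (setsum_sub sM) => //.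
    by apply: sub_line => //; apply: subsetP LM v vL.
  apply/subsetP=> x; rewrite defM.
  case/imset2P=> _ _ /imset2P[w _ wO /imsetP[a aK ->] ->] /imsetP[b bK ->] ->.
  set l := a *: v1 + b *: v2; rewrite -addrA -/l addrC.
  have lL : l \in L.
    by apply/imset2P; exists (a *: v1) (b *: v2) => //; apply/imsetP; [exists a | exists b].
  have v1L : v1 \in L by apply: subsetP (setsum_subl (line_of K v1) (sl v2)) _ (mem_line K_field _).
  (* A vector of O has no projection point on L; it is put over the arbitrary base point of v1. *)
  have [l0|l0] := eqVneq l 0.
    apply/bigcupP; exists (line_of K v1); first by apply/imsetP; exists v1 => //; apply/setD1P.
    by apply/imset2P; exists l w; rewrite // l0 (subspace0 (sl v1)).
  apply/bigcupP; exists (line_of K l); first by apply/imsetP; exists l => //; apply/setD1P.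
  by apply/imset2P; exists l w; rewrite // mem_line.
apply: minimal_blocking_eq mB _ _.
  apply: (blocking_B_D K_field sM); last exact: ltnW (ltnW _).
  by rewrite cM cardF ltn_exp2l.
rewrite defB; apply/subsetP=> P /B_DP[v [v0 vM ->]]; apply/B_DP; exists v; split=> //.
exact: subsetP MU v vM.
Qed.

End LinearToCone.

(** * Cones are linear blocking sets *)

Section ConeToLinear.
Variables (F : finFieldType) (n : nat) (K : {set F}).
Local Notation V := 'rV[F]_n.
Local Notation q := #|K|.
Local Notation Q := #|F|.
Local Notation R := (Q ^ (n - 2))%N.
Variables (O G : {set V}) (Bbar : {set {set V}}).
Hypotheses (K_field : divring_closed K) (q_ge7 : (7 <= q)%N) (n_ge3 : (3 <= n)%N).
Hypotheses (sO : is_subspace K O) (sG : is_subspace K G).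
Hypotheses (cO : (#|O| * q = Q)%N) (cG : #|G| = (q ^ 3)%N) (OG : O :&: G = [set 0]).
Hypothesis (pbB : plane_blocking K q G Bbar).
Let W := setsum O G.
Let B := B_D (cone O Bbar).
Implicit Types (a : F) (v w c : V) (L : {set V}).

(** Membership in the base, moved from points to their representing vectors; by [on_baseZ] the
    representative does not matter. *)
Definition on_base c := [&& c != 0, c \in G & line_of K c \in Bbar].

Let sl v : is_subspace K (line_of K v) := subspace_line K_field v.

Lemma line_scale a v : a \in K -> a != 0 -> line_of K (a *: v) = line_of K v.
Proof.
move=> aK a0; have [->|v0] := eqVneq v 0; first by rewrite scaler0.
apply/eqP; rewrite eqEcard !card_line ?leqnn ?scaler_eq0 ?negb_or ?a0 ?v0 // andbT.
by apply: (sub_line (sl v)); apply/imsetP; exists a.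
Qed.

Lemma on_baseZ a c : a \in K -> a != 0 -> on_base (a *: c) = on_base c.
Proof.
move=> aK a0; rewrite /on_base line_scale // scaler_eq0 negb_or a0.
by rewrite (subspaceZE K_field c sG aK a0).
Qed.

Lemma base_neq0 c : on_base c -> c != 0. Proof. by case/and3P. Qed.
Lemma base_plane c : on_base c -> c \in G. Proof. by case/and3P. Qed.

Lemma base_meets L : is_subspace K L -> L \subset G -> #|L| = (q ^ 2)%N ->
  exists2 c, on_base c & c \in L.
Proof.
move=> sL LG cL; case/andP: pbB => /forall_inP ptB /forallP blB.
have /exists_inP[P PB PL] : [exists P in Bbar, P \subset L].
  by apply: implyP (blB L) _; rewrite sL LG cL eqxx.
have /andP[/existsP[c /andP[c0 /eqP defP]] _] := ptB P PB.
have cL' : c \in L by apply: (subsetP PL); rewrite defP; apply: mem_line.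
exists c => //; rewrite /on_base c0 (subsetP LG) //=.
by move: PB; rewrite defP.
Qed.

Lemma cone_decomp w w' c c' : w \in O -> w' \in O -> c \in G -> c' \in G ->
  w + c = w' + c' -> w = w' /\ c = c'.
Proof.
move=> wO wO' cG' cG'' /(congr1 (fun z => z - w' - c)).
rewrite addrAC addrK [w' + c']addrC addrK => E.
have : w - w' \in O :&: G.
  by rewrite inE (subspaceB K_field sO) //= E (subspaceB K_field sG).
rewrite OG => /set1P ww; split; first by apply/eqP; rewrite -subr_eq0 ww.
by apply/esym/eqP; rewrite -subr_eq0 -E ww.
Qed.

Lemma card_W : #|W| = (q ^ 2 * Q)%N.
Proof.
by rewrite (card_setsum K_field sO sG) ?OG ?subxx // cG -cO; rewrite !expnS; lia.
Qed.

Lemma subspace_W : is_subspace K W.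
Proof. exact: subspace_setsum. Qed.

Lemma subOW : O \subset W. Proof. exact: setsum_subl sG. Qed.
Lemma subGW : G \subset W. Proof. exact: setsum_subr sO. Qed.

(** The cone is a union over base points, so a nonempty base is what puts the vertex inside it; any
    line of G supplies a base point. *)
Lemma exists_base : exists c, on_base c.
Proof.
have [||L [sL _ LG cL]] := intermediate_subspace K_field (d := 2) (subspace_0 n K) sG.
- by rewrite sub1set (subspace0 sG).
- by rewrite cards1 mul1n cG leq_exp2l // card_subfield_gt1.
have [|c bc _] := base_meets sL LG; last by exists c.
by rewrite cL cards1 mul1n.
Qed.

Lemma coneP v :
  reflect (v \in O \/ exists w c, [/\ w \in O, on_base c & v = w + c])
          (v \in cone O Bbar).
Proof.
apply: (iffP bigcupP) => [[P PB /imset2P[x y xP yO ->]]|].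
  case/andP: pbB => /forall_inP ptB _.
  have /andP[/existsP[c /andP[c0 /eqP defP]] PG] := ptB P PB.
  have [x0|x0] := eqVneq x 0; first by left; rewrite x0 add0r.
  right; exists y, x; split=> //; last exact: addrC.
  rewrite /on_base x0 (subsetP PG) //=; move: xP; rewrite defP => /imsetP[a aK E].
  have lP : line_of K c = P := esym defP.
  rewrite E line_scale ?lP //.
  by apply: contraNneq x0 => a0; rewrite E a0 scale0r.
case=> [vO|[w [c [wO /and3P[c0 cG' lB] ->]]]].
  have [c /and3P[c0 cG' lB]] := exists_base.
  exists (line_of K c) => //; apply/imset2P; exists 0 v; rewrite ?add0r //.
  exact: subspace0 (sl c).
exists (line_of K c) => //; apply/imset2P; exists c w; rewrite ?mem_line //.
exact: addrC.
Qed.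

Lemma cone_subW : cone O Bbar \subset W.
Proof.
apply/subsetP=> v /coneP[|[w [c [wO bc ->]]]]; first exact: (subsetP subOW).
by apply/imset2P; exists w c => //; apply: base_plane.
Qed.

Lemma linear_of_full_line L : minimal_blocking_hyp B ->
  is_subspace K L -> L \subset G -> #|L| = (q ^ 2)%N ->
  (forall c, c \in L -> c != 0 -> on_base c) -> B = B_D (setsum O L).
Proof.
move=> mB sL LG cL full; have sOL : is_subspace K (setsum O L) by apply: subspace_setsum.
apply: (minimal_blocking_eq mB).
  apply: (blocking_B_D K_field sOL); last exact: ltnW (ltnW _).
  rewrite (card_setsum K_field sO sL) ?cL; last by rewrite -OG setIS.
  rewrite expnS expn1 mulnA cO ltn_Pmulr ?card_subfield_gt1 //.
  by rewrite ltnW // finNzRing_gt1.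
apply/subsetP=> P /B_DP[v [v0 vOL ->]]; apply/B_DP; exists v; split=> //.
apply/coneP; case/imset2P: vOL => w c wO cL' ->.
have [->|c0] := eqVneq c 0; first by left; rewrite addr0.
by right; exists w, c; rewrite full.
Qed.

Lemma cardQ : (Q ^ (n - 1) = Q * R)%N.
Proof. by rewrite -expnS -subSn // ltnW. Qed.

Lemma q_gt1 : (1 < q)%N. Proof. exact: card_subfield_gt1. Qed.

Lemma leqQ : (q <= Q)%N. Proof. exact: max_card. Qed.

Lemma leqR : (q <= R)%N.
Proof.
apply: leq_trans leqQ _; rewrite -{1}(expn1 Q) leq_exp2l ?subn_gt0 //.
exact: finNzRing_gt1.
Qed.

(** W has q^2 Q vectors and a hyperplane has index Q in V. *)
Lemma card_W_hyperplane H : is_hyperplane H -> (q ^ 2 <= #|W :&: H|)%N.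
Proof.
move=> hH; have Q0 : (0 < Q)%N by rewrite ltnW // finNzRing_gt1.
rewrite -(leq_pmul2r Q0) -card_W.
by apply: (card_subspaceI_hyperplane _ subspace_W hH); apply: ltnW (ltnW _).
Qed.

(** This is [sum_orth] for W, with the vectors of W off the point of v counted as a difference; the
    subtracted term is moved to the left to stay in the natural numbers. *)
Lemma sum_orth_W v : v != 0 ->
  (\sum_(f : V | (f != 0%R) && orth f v) #|W :&: ker f| + q ^ 2 * Q + #|W :&: point v| * R =
   #|W :&: point v| * (Q * R) + q ^ 2 * Q * R)%N.
Proof.
move=> v0; have := sum_orth W v0; rewrite card_W cardQ => ->.
rewrite -addnA -mulnDl; congr (_ + _ * _)%N.
by rewrite -card_W -(cardsID (point v) W) addnC.
Qed.

(* In the language of linear sets: the point of v has weight one in W. *)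
Definition light v := W :&: point v \subset line_of K v.

Lemma card_light v : v != 0 -> v \in W -> light v -> #|W :&: point v| = q.
Proof.
move=> v0 vW lv; rewrite -(card_line K v0); congr #|pred_of_set _|; apply/eqP; rewrite eqEsubset.
apply/andP; split=> //; rewrite subsetI (sub_line subspace_W vW).
by apply/subsetP=> _ /imsetP[a _ ->]; apply/imsetP; exists a; rewrite ?in_setT.
Qed.

(* Otherwise each f orthogonal to k and to a vector of S satisfies
   |W :&: ker f| >= q^3; summing over all f orthogonal to k, this is too much. *)
Lemma exists_secant k (S : {set V}) : k != 0 -> k \in W -> light k -> S \subset W ->
  [disjoint S & line_of K k] -> #|S| = (2 * (q.-1 * Q))%N ->
  exists f u, [/\ f != 0, orth f k, u \in S, orth f u & (#|W :&: ker f| < q ^ 3)%N].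
Proof.
move=> k0 kW lk SW dS cS.
have [/existsP[f /and4P[f0 fk lt /exists_inP[u uS fu]]]|none] :=
  boolP [exists f : V, [&& f != 0, orth f k, (#|W :&: ker f| < q ^ 3)%N &
                          [exists u in S, orth f u]]].
  by exists f, u.
(* As k is light, avoiding the K-line of k amounts, inside W, to avoiding its F-point. *)
have Sk0 : S :&: point k = set0.
  apply/setP=> x; rewrite !inE; apply/negP=> /andP[xS xk].
  have xl : x \in line_of K k by apply: (subsetP lk); rewrite inE xk (subsetP SW).
  by move/pred0P: dS => /(_ x) /=; rewrite xS xl.
have E1 := sum_orth S k0; rewrite Sk0 cards0 mul0n add0n in E1.
have cSD : #|S :\: point k| = #|S| by rewrite -(cardsID (point k) S) Sk0 cards0 add0n.
rewrite cSD cS in E1.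
have E2 := sum_orth_W k0; rewrite card_light // in E2.
have := secant_estimate q_ge7 leqQ leqR E1 E2; rewrite ltnNge => /negP[].
rewrite -cardQ -(sum_orth_const _ k0) !big_distrr -big_split /=.
apply: leq_sum => f /andP[f0 fk].
have le2 := card_W_hyperplane (ker_hyperplane f0).
have [A0|[u]] := set_0Vmem (S :&: ker f).
  by rewrite A0 cards0 muln0 add0n leq_mul2l le2 orbT.
rewrite !inE => /andP[uS fu].
have le3 : (q ^ 3 <= #|W :&: ker f|)%N.
  rewrite leqNgt; apply: contra none => lt; apply/existsP; exists f.
  by rewrite f0 fk lt; apply/exists_inP; exists u.
(* [S :&: ker f] and the q vectors of the K-line of k are disjoint parts of [W :&: ker f]. *)
have leA : (#|S :&: ker f| + q <= #|W :&: ker f|)%N.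
  have sf := ker_subspace K f0.
  have kl : line_of K k \subset W :&: ker f.
    by rewrite subsetI (sub_line subspace_W kW) (sub_line sf) // inE.
  rewrite -(card_line K k0) -cardsUI (_ : _ :&: line_of K k = set0) ?cards0 ?addn0.
    by rewrite subset_leq_card // subUset kl setSI.
  apply/setP=> x; rewrite !inE; apply/negP=> /andP[/andP[xS _] xl].
  by move/pred0P: dS => /(_ x) /=; rewrite xS xl.
exact: pointwise_estimate.
Qed.

(* The points of B in ker f are the point of k and the points of a k + u with
   a g + b in the base; as there are 1 mod q of them, q divides the number of
   such a, which is positive because of a = 0. *)
Lemma secant_line_full f k u w w' g b :
  f != 0 -> (#|[set P in B | P \subset ker f]| = 1 %[mod q])%N ->
  k = w + g -> u = w' + b -> w \in O -> w' \in O -> on_base g -> on_base b ->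
  b \notin line_of K g -> light k -> W :&: ker f = setsum (line_of K k) (line_of K u) ->
  forall a, a \in K -> on_base (a *: g + b).
Proof.
move=> f0 modT defk defu wO wO' bg bb nbg lk defD.
have gG := base_plane bg; have bG := base_plane bb.
have gbG (a c : F) : a \in K -> c \in K -> a *: g + c *: b \in G.
  by move=> aK cK; rewrite (subspaceD sG) // (subspaceZ sG).
have wwO (a c : F) : a \in K -> c \in K -> a *: w + c *: w' \in O.
  by move=> aK cK; rewrite (subspaceD sO) // (subspaceZ sO).
have combE (a c : F) : a *: k + c *: u = (a *: w + c *: w') + (a *: g + c *: b).
  by rewrite defk defu !scalerDr addrACA.
have gb0 (a c : F) : a \in K -> c \in K -> a *: g + c *: b = 0 -> a = 0 /\ c = 0.
  move=> aK cK E; have c0 : c = 0.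
    apply/eqP; apply: contraNT nbg => c0.
    rewrite -(subspaceZE K_field b (sl g) cK c0) -(subspaceDr K_field _ (sl g) (v := a *: g)).
      by rewrite addrC E (subspace0 (sl g)).
    by apply/imsetP; exists a.
  split=> //; move/eqP: E; rewrite c0 scale0r addr0 scaler_eq0 (negPf (base_neq0 bg)) orbF.
  by move/eqP.
have ku0 (a c : F) : a \in K -> c \in K -> a *: k + c *: u = 0 -> a = 0 /\ c = 0.
  move=> aK cK; rewrite combE => E.
  have [|||||_ E'] := @cone_decomp (a *: w + c *: w') 0 (a *: g + c *: b) 0.
  - exact: wwO.
  - exact: subspace0 sO.
  - exact: gbG.
  - exact: subspace0 sG.
  - by rewrite E addr0.
  exact: gb0.
have K1 := subfield1 K_field; have K0 := subfield0 K_field.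
have k0 : k != 0.
  apply/eqP=> E; have [|/eqP] := ku0 1 0 K1 K0; last by rewrite oner_eq0.
  by rewrite E scaler0 scale0r addr0.
have sW := subspace_W; have sf := ker_subspace K f0.
have kD : k \in W :&: ker f.
  by rewrite defD (subsetP (setsum_subl _ (sl u))) // mem_line.
have uD : u \in W :&: ker f by rewrite defD mem_adjoin.
have [/setIP[kW kf] /setIP[uW uf]] := (kD, uD).
have sH : is_subspace setT (ker f) := hyperplane_subspace (ker_hyperplane f0).
(* If a k + u, hence u, lay in the F-point of k, lightness would put u in the K-line of k, against
   independence. *)
have nuk a : a \in K -> a *: k + u \notin point k.
  move=> aK; apply/negP=> auk.
  have : u \in line_of K k.
    apply: (subsetP lk); rewrite inE uW /=.
    rewrite -(subspaceDr (setT_closed F) _ (subspace_point k) (v := a *: k)) 1?addrC //.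
    by apply/imsetP; exists a; rewrite ?in_setT.
  case/imsetP=> c cK E; have [|_ /eqP] := ku0 (- c) 1 (subfieldN K_field cK) K1.
    by rewrite E scale1r scaleNr addNr.
  by rewrite oner_eq0.
set A := [set a in K | on_base (a *: g + b)].
have AK : A \subset K by apply/subsetP=> a; rewrite inE => /andP[].
have ak_pt a : a *: k + u = 0 -> a \notin K.
  move=> E; apply/negP=> aK; have [|_ /eqP] := ku0 a 1 aK K1; last by rewrite oner_eq0.
  by rewrite scale1r.
(* A cone vector a k + c u has G-component a g + c b, which is nonzero and so must lie on the base.
   For c = 0 its point is that of k; otherwise division by c brings it to the form a k + u. *)
have defT : [set P in B | P \subset ker f] = point k |: [set point (a *: k + u) | a in A].
  apply/setP=> P; apply/setIdP/setU1P.
    move=> [/B_DP[v [v0 vC ->]]]; rewrite point_sub // => vf.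
    have : v \in W :&: ker f by rewrite inE vf (subsetP cone_subW).
    rewrite defD => /imset2P[_ _ /imsetP[a aK ->] /imsetP[c cK ->] defv].
    case/coneP: vC => [vO|[w'' [c' [wO'' bc' E]]]].
      have [|||||_ E'] := @cone_decomp (a *: w + c *: w') v (a *: g + c *: b) 0.
      - exact: wwO.
      - by [].
      - exact: gbG.
      - exact: subspace0 sG.
      - by rewrite addr0 -combE.
      by have [a0 c0] := gb0 a c aK cK E'; case/eqP: v0; rewrite defv a0 c0 !scale0r addr0.
    have [|||||_ E'] := @cone_decomp (a *: w + c *: w') w'' (a *: g + c *: b) c'.
    - exact: wwO.
    - by [].
    - exact: gbG.
    - exact: base_plane.
    - by rewrite -E -combE.
    have [c0|c0] := eqVneq c 0.
      left; apply: (eq_point v0); apply/imsetP; exists a; rewrite ?in_setT //.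
      by rewrite defv c0 scale0r addr0.
    have acK : c^-1 * a \in K by rewrite (subfieldM K_field) // (subfieldV K_field).
    have sc x y : a *: x + c *: y = c *: ((c^-1 * a) *: x + y).
      by rewrite scalerDr scalerA mulrA mulfV // mul1r.
    right; apply/imsetP; exists (c^-1 * a); first by rewrite inE acK -(on_baseZ _ cK c0) -sc E'.
    apply: (eq_point v0); apply/imsetP; exists c; rewrite ?in_setT //.
    by rewrite defv sc.
  case=> [->|/imsetP[a /setIdP[aK ba] ->]].
    rewrite point_sub //; split=> //; apply/B_DP; exists k; split=> //.
    by apply/coneP; right; exists w, g.
  have au0 : a *: k + u != 0 by apply/eqP=> /ak_pt; rewrite aK.
  rewrite point_sub // (subspaceD sH) ?(subspaceZ sH) ?in_setT //; split=> //.
  apply/B_DP; exists (a *: k + u); split=> //; apply/coneP; right.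
  exists (a *: w + w'), (a *: g + b); split=> //.
    by rewrite (subspaceD sO) // (subspaceZ sO).
  by rewrite -[u]scale1r combE !scale1r.
(* If two of these points coincided, the difference (a - a') k would lie in that point, against
   [nuk]. *)
have injA : {in A &, injective (fun a => point (a *: k + u))}.
  move=> a a' /setIdP[aK _] /setIdP[aK' _] E; apply/eqP; apply: contraT => neq.
  have d0 : a - a' != 0 by rewrite subr_eq0.
  have: (a - a') *: k \in point (a' *: k + u).
    have -> : (a - a') *: k = (a *: k + u) - (a' *: k + u).
      by rewrite opprD addrACA subrr addr0 scalerBl.
    rewrite (subspaceB (setT_closed F) (subspace_point _)) ?mem_point //.
    by rewrite -E mem_point.
  rewrite (subspaceZE (setT_closed F) _ (subspace_point _)) ?in_setT // => kin.
  by have := point_sym k0 kin; rewrite (negPf (nuk a' aK')).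
move: modT; rewrite defT cardsU1 card_in_imset // (_ : point k \notin _); last first.
  apply/imsetP=> -[a /setIdP[aK _] E]; have := nuk a aK; rewrite E mem_point //.
rewrite add1n -addn1 -{2}[1%N]add0n => /eqP; rewrite eqn_modDr mod0n => dvA.
have A0 : (0 < #|A|)%N by apply/card_gt0P; exists 0; rewrite inE K0 scale0r add0r.
have defA : A = K by apply/eqP; rewrite eqEcard AK dvdn_leq.
by move=> a; rewrite -defA inE => /andP[].
Qed.

(** * Base without a full line: cone vectors outside the vertex are heavy *)

Section NoFullLine.
Hypothesis no_full_line : forall L, is_subspace K L -> L \subset G -> #|L| = (q ^ 2)%N ->
  exists c, [/\ c \in L, c != 0 & ~~ on_base c].

(** Some point x of L is not in the base. Another line of G through x is blocked at a point other
    than x, hence off L. *)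
Lemma base_off_line L : is_subspace K L -> L \subset G -> #|L| = (q ^ 2)%N ->
  exists2 c, on_base c & c \notin L.
Proof.
move=> sL LG cL; have [x [xL x0 nbx]] := no_full_line sL LG cL.
have [y yG yL] : exists2 y, y \in G & y \notin L.
  apply/subsetPn; apply/negP=> /subset_leq_card; rewrite cG cL.
  by rewrite leq_exp2l // card_subfield_gt1.
have yx : y \notin line_of K x by apply: contra yL; apply/subsetP/(sub_line sL).
have sL' : is_subspace K (setsum (line_of K x) (line_of K y)) by apply: subspace_setsum.
have [||c bc cL'] := base_meets sL'.
- by rewrite (setsum_sub sG) // (sub_line sG) // (subsetP LG).
- by rewrite (card_adjoin K_field (sl x) yx) card_line.
exists c => //; apply: contra nbx => cinL.
move: cL' => /imset2P[_ _ /imsetP[a aK ->] /imsetP[b bK ->] defc].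
have axL : a *: x \in L by apply: (subspaceZ sL).
have b0 : b = 0.
  apply/eqP; apply: contraNT yL => b0; rewrite -(subspaceZE K_field y sL bK b0).
  by rewrite -(subspaceDr K_field _ sL axL) addrC -defc.
move: defc; rewrite b0 scale0r addr0 => defc.
rewrite -(@on_baseZ a) -?defc //; apply: contraTneq bc => a0.
by rewrite defc a0 scale0r /on_base eqxx.
Qed.

(** Completes g to three non-collinear base points; b1 and b2 provide the two pieces of S that
    [secant_estimate] requires. *)
Lemma independent_base g : on_base g ->
  exists b1 b2, [/\ on_base b1, on_base b2, b1 \notin line_of K g &
                    b2 \notin setsum (line_of K g) (line_of K b1)].
Proof.
move=> bg; have cg : #|line_of K g| = q by rewrite card_line ?base_neq0.
have lG v : v \in G -> line_of K v \subset G by apply: sub_line.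
have [y yG yg] : exists2 y, y \in G & y \notin line_of K g.
  apply/subsetPn; apply/negP=> /subset_leq_card; rewrite cG cg -{2}(expn1 q).
  by rewrite leq_exp2l // card_subfield_gt1.
have [|||b1 bb1 b1L] := @base_off_line (setsum (line_of K g) (line_of K y)).
- exact: subspace_setsum.
- by rewrite (setsum_sub sG) ?lG // base_plane.
- by rewrite (card_adjoin K_field (sl g) yg) cg.
have b1g : b1 \notin line_of K g.
  by apply: contra b1L; apply/subsetP/(setsum_subl _ (sl y)).
have [|||b2 bb2 b2L] := @base_off_line (setsum (line_of K g) (line_of K b1)).
- exact: subspace_setsum.
- by rewrite (setsum_sub sG) ?lG // base_plane.
- by rewrite (card_adjoin K_field (sl g) b1g) cg.
by exists b1, b2.
Qed.

Hypothesis modB : forall H, is_hyperplane H -> (#|[set P in B | P \subset H]| = 1 %[mod q])%N.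

Lemma base_notin_O c : on_base c -> c \notin O.
Proof.
move=> bc; apply/negP=> cO'; have : c \in O :&: G by rewrite inE cO' base_plane.
by rewrite OG inE (negPf (base_neq0 bc)).
Qed.

(** Let k lie over the base point g. In the spans of O, g and b1 and of O, g and b2, the vectors
    outside [O1] form a set S of 2 (q - 1) Q vectors that all project from O onto one of two secants
    through g. For light k, [exists_secant] and [secant_line_full] make one of these secants a full
    line. *)
Lemma cone_not_light k : k \in cone O Bbar -> k \notin O -> ~~ light k.
Proof.
move=> kC kO; apply/negP=> lk.
case/coneP: (kC) => [kO'|[w0 [g [wO0 bg defk]]]]; first by rewrite kO' in kO.
have [b1 [b2 [bb1 bb2 nb1 nb2]]] := independent_base bg.
have gG := base_plane bg; have sW := subspace_W.
have kW : k \in W := subsetP cone_subW k kC.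
have k0 : k != 0 by apply: contraNneq kO => ->; apply: subspace0 sO.
set O1 := setsum O (line_of K g).
have sO1 : is_subspace K O1 by apply: subspace_setsum.
have cO1 : #|O1| = Q by rewrite (card_adjoin K_field sO) ?base_notin_O.
have O1P v : v \in O1 -> exists w a, [/\ w \in O, a \in K & v = w + a *: g].
  by case/imset2P=> w _ wO /imsetP[a aK ->] ->; exists w, a.
have agG a : a \in K -> a *: g \in G by move=> aK; apply: (subspaceZ sG).
have OO1 w : w \in O -> w \in O1 by apply: (subsetP (setsum_subl _ (sl g))).
have gO1 : g \in O1 by rewrite mem_adjoin.
have kO1 : k \in O1 by rewrite defk (subspaceD sO1) // OO1.
have bO1 b : on_base b -> b \notin line_of K g -> b \notin O1.
  move=> bb nb; apply: contra nb => /O1P[w [a [wO aK E]]].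
  have [|||||_ ->] := @cone_decomp 0 w b (a *: g); rewrite ?add0r ?agG ?base_plane //.
    exact: subspace0 sO.
  by apply/imsetP; exists a.
pose D b := setsum O1 (line_of K b).
have sD b : is_subspace K (D b) by apply: subspace_setsum.
have O1D b : O1 \subset D b := setsum_subl _ (sl b).
have cD b : on_base b -> b \notin line_of K g -> #|D b :\: O1| = (q.-1 * Q)%N.
  move=> bb nb; rewrite cardsD (setIidPr (O1D b)) (card_adjoin K_field sO1) ?bO1 // cO1.
  by rewrite -[in RHS]subn1 mulnBl mul1n mulnC.
have nb2g : b2 \notin line_of K g.
  by apply: contra nb2; apply/subsetP/(setsum_subl _ (sl b1)).
have b2D : b2 \notin D b1.
  apply: contra nb2 => /imset2P[_ _ /O1P[w [a [wO aK ->]]] /imsetP[c cK ->] E].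
  have agc : a *: g + c *: b1 \in G by rewrite (subspaceD sG) ?agG // (subspaceZ sG) ?base_plane.
  have [|||||_ ->] := @cone_decomp 0 w b2 (a *: g + c *: b1); rewrite ?add0r ?agc ?base_plane //.
  - exact: subspace0 sO.
  - by rewrite addrA.
  by apply/imset2P; exists (a *: g) (c *: b1) => //; apply/imsetP; [exists a | exists c].
pose S := (D b1 :\: O1) :|: (D b2 :\: O1).
have cS : #|S| = (2 * (q.-1 * Q))%N.
  rewrite cardsU !cD // (_ : _ :&: _ = set0) ?cards0 ?subn0 ?mul2n ?addnn //.
  apply/setP=> x; rewrite !inE; apply/negP=> /andP[/andP[xO1 xD1] /andP[_]].
  case/imset2P=> o _ oO1 /imsetP[c cK ->] E.
  have oD1 : o \in D b1 := subsetP (O1D b1) o oO1.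
  have c0 : c != 0 by apply: contraNneq xO1 => c0; rewrite E c0 scale0r addr0.
  case/negP: b2D; rewrite -(subspaceZE K_field b2 (sD b1) cK c0).
  by rewrite -(subspaceDr K_field _ (sD b1) oD1) addrC -E.
have OW1 : O1 \subset W.
  by rewrite (setsum_sub sW) ?subOW // (sub_line sW) // (subsetP subGW).
have DW b : on_base b -> D b \subset W.
  by move=> bb; rewrite (setsum_sub sW) // (sub_line sW) // (subsetP subGW) ?base_plane.
have SW : S \subset W.
  by rewrite subUset !subDset !(subset_trans (DW _ _)) ?subsetUr.
have dS : [disjoint S & line_of K k].
  rewrite disjoint_sym; apply: disjointWl (sub_line sO1 kO1) _.
  by rewrite disjoints_subset; apply/subsetP=> x xO1; rewrite !inE xO1.
have [f [u [f0 fk uS fu lt]]] := exists_secant k0 kW lk SW dS cS.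
have fin b : on_base b -> b \notin line_of K g -> u \in D b :\: O1 -> False.
  move=> bb nb /setDP[/imset2P[_ _ /O1P[w [a [wO aK ->]]] /imsetP[c cK ->] defu] uO1].
  have c0 : c != 0.
    apply: contraNneq uO1 => c0; rewrite defu c0 scale0r addr0 (subspaceD sO1) //; first exact: OO1.
    exact: (subspaceZ sO1).
  have cVK := subfieldV K_field cK.
  (* Subtracting a k from u and dividing by c leaves b as the G-component, the normal form required
     by [secant_line_full]. *)
  pose w' := c^-1 *: (w - a *: w0); pose u' := c^-1 *: (u - a *: k).
  have wO' : w' \in O by rewrite (subspaceZ sO) // (subspaceB K_field sO) // (subspaceZ sO).
  have defu' : u' = w' + b.
    transitivity (c^-1 *: ((w - a *: w0) + c *: b)).
      by rewrite /u' defu defk [a *: (w0 + g)]scalerDr opprD addrAC addrACA subrr addr0.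
    by rewrite scalerDr scalerA mulVf // scale1r.
  have sf := ker_subspace K f0; have sWf := subspaceI sW sf.
  have uW : u \in W by apply: (subsetP SW).
  have kD : k \in W :&: ker f by rewrite inE kW inE.
  have uD : u' \in W :&: ker f.
    rewrite (subspaceZ sWf) // (subspaceB K_field sWf) ?(subspaceZ sWf) //.
    by rewrite inE uW inE.
  have nuk : u' \notin line_of K k.
    apply: contra nb => /imsetP[d dK]; rewrite defu' defk scalerDr => E.
    have [|||||_ ->] := @cone_decomp w' (d *: w0) b (d *: g); rewrite ?agG ?base_plane //.
      exact: (subspaceZ sO).
    by apply/imsetP; exists d.
  (* The section contains the rank 2 span of k and u'; anything more would raise its size to q^3. *)
  have defD : W :&: ker f = setsum (line_of K k) (line_of K u').
    have sE : is_subspace K (setsum (line_of K k) (line_of K u')) by apply: subspace_setsum.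
    have ED : setsum (line_of K k) (line_of K u') \subset W :&: ker f.
      by rewrite adjoin_sub // (sub_line sWf).
    apply/eqP; rewrite eqEsubset ED andbT; apply: contraTT lt => /subsetPn[x xD xE].
    have := card_lt_subspace K_field sE sWf ED xD xE.
    by rewrite (card_adjoin K_field (sl k) nuk) card_line // -leqNgt !expnS expn0 muln1 mulnA.
  have full := secant_line_full f0 (modB (ker_hyperplane f0)) defk defu' wO0 wO' bg bb nb lk defD.
  have [|||x [/imset2P[_ _ /imsetP[d dK ->] /imsetP[e eK ->] ->] x0]] :=
    no_full_line (L := setsum (line_of K g) (line_of K b)).
  - exact: subspace_setsum.
  - by rewrite (setsum_sub sG) // (sub_line sG) // base_plane.
  - by rewrite (card_adjoin K_field (sl g) nb) card_line ?base_neq0.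
  (* A nonzero vector of the secant is a multiple of g or of some a g + b, so the secant is full. *)
  have [e0|e0] := eqVneq e 0.
    move: x0; rewrite e0 scale0r addr0 => x0; rewrite on_baseZ ?bg //.
    by apply: contraNneq x0 => ->; rewrite scale0r.
  have -> : d *: g + e *: b = e *: ((e^-1 * d) *: g + b).
    by rewrite scalerDr scalerA mulrA mulfV // mul1r.
  by rewrite on_baseZ // full // (subfieldM K_field) // (subfieldV K_field).
by case/setUP: uS; apply: fin.
Qed.

End NoFullLine.

(** * Cones whose vectors outside the vertex are heavy *)

(** Each nonzero vector lies in exactly one F-point; 0, which lies in all of them, has to be kept
    out of X. *)
Lemma sum_card_points (T : {set {set V}}) (X : {set V}) :
  {in T, forall P, exists2 v, v != 0 & P = point v} -> 0 \notin X ->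
  (\sum_(P in T) #|X :&: P| = #|[set v in X | point v \in T]|)%N.
Proof.
move=> ptT X0; under eq_bigr do rewrite -sum1_card.
rewrite (exchange_big_dep (mem X)) /=; last by move=> P v _ /setIP[].
rewrite -sum1_card [RHS](eq_bigl (fun v => (v \in X) && (point v \in T))); last first.
  by move=> v; rewrite inE.
rewrite big_mkcondr /=; apply: eq_bigr => v vX.
have v0 : v != 0 by apply: contraNneq X0 => <-.
rewrite (eq_bigl (fun P => (P \in T) && (P == point v))); last first.
  move=> P; rewrite inE vX /=; case PT: (P \in T) => //=.
  have [w w0 ->] := ptT P PT; apply/idP/eqP=> [vw|->]; last exact: mem_point.
  by rewrite (eq_point v0 vw).
case: ifP => [pT|pT].
  by rewrite (big_pred1 (point v)) // => P /=; case: eqP => [->|]; rewrite ?pT ?andbF.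
by rewrite big1 // => P /andP[PT /eqP E]; rewrite E pT in PT.
Qed.

(** The K-subspace [W :&: point v] properly contains the K-line of v, so its rank is at least 2. *)
Lemma card_heavy v : v \in W -> ~~ light v -> (q ^ 2 <= #|W :&: point v|)%N.
Proof.
move=> vW hv; have v0 : v != 0.
  apply: contraNneq hv => ->; rewrite /light; apply/subsetP=> x /setIP[_ /imsetP[a _ ->]].
  by rewrite scaler0 (subspace0 (sl 0)).
have sWv := subspaceI subspace_W (subspace_restrict K (subspace_point v)).
case/subsetPn: hv => x xWv xl.
have vWv : v \in W :&: point v by rewrite inE vW mem_point.
have := card_lt_subspace K_field (sl v) sWv (sub_line sWv vWv) xWv xl.
by rewrite card_line.
Qed.

Section ConeHeavy.
Hypotheses (bB : blocking_hyp B)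
  (cone_heavy : forall k, k \in cone O Bbar -> k \notin O -> ~~ light k).
Let Z := [set v in W | (v != 0) && light v].

Let points_B : {in B, forall P, exists2 v, v != 0 & P = point v}.
Proof. by move=> P; apply: blocking_point bB. Qed.

(** A point of B with fewer than q^2 vectors in W comes from a vector of O and so uses q - 1 nonzero
    vectors of O. Any other point of B uses at least q^2 - 1 nonzero vectors of W, none of them
    light. As |B| > Q, few vectors of W remain to be light. *)
Lemma card_light_vectors : (#|Z| <= 3 * Q)%N.
Proof.
set h := #|[set P in B | q ^ 2 <= #|W :&: P|]|%N.
set l := #|[set P in B | #|W :&: P| < q ^ 2]|%N.
have O0 : 0 \in O := subspace0 sO; have W0 : 0 \in W := subspace0 subspace_W.
have ptT (p : pred {set V}) : {in [set P in B | p P], forall P, exists2 v, v != 0 & P = point v}.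
  by move=> P /setIdP[/points_B].
have cardD1 (X : {set V}) : 0 \in X -> #|X :\ 0| = #|X|.-1 by move=> X0; rewrite (cardsD1 0 X) X0.
apply: (light_count_estimate q_ge7 (leq_trans (ltnW q_gt1) leqQ) cO (h := h) (l := l)) => //.
- have <- : #|B| = (h + l)%N.
    rewrite /h /l -cardsUI (_ : _ :&: _ = set0) ?cards0 ?addn0; last first.
      by apply/setP=> P; rewrite !inE ltnNge; case: (_ <= _)%N; rewrite !andbF.
    congr #|pred_of_set _|; apply/setP=> P; apply/idP/setUP=> [PB|[] /setIdP[]//].
    by case: (leqP (q ^ 2) #|W :&: P|) => leP; [left | right]; apply/setIdP.
  by apply: card_blocking => //; apply: ltnW (ltnW _).
- have ZW : Z \subset W :\ 0 by apply/subsetP=> v /setIdP[vW /andP[v0 _]]; rewrite !inE v0.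
  have cWZ : (#|(W :\ 0%R) :\: Z| + #|Z| = (q ^ 2 * Q).-1)%N.
    rewrite -card_W -cardD1 // -[in RHS](cardsID Z (W :\ 0)) addnC.
    by rewrite (setIidPr ZW).
  rewrite -cWZ leq_add2r /h -sum_nat_const.
  apply: (@leq_trans (\sum_(P in [set P in B | q ^ 2 <= #|W :&: P|])
                        #|((W :\ 0%R) :\: Z) :&: P|)%N).
    apply: leq_sum => P /setIdP[] /points_B[v v0 ->] le_v.
    have X0 : 0 \in W :&: point v by rewrite inE W0 (subspace0 (subspace_point v)).
    rewrite -ltnS prednK ?expn_gt0 ?(ltnW q_gt1) //.
    apply: (leq_trans le_v); rewrite (cardsD1 0) X0 ltnS; apply: subset_leq_card.
    apply/subsetP=> w /setD1P[w0 /setIP[wW wv]]; rewrite !inE wv wW w0 /= !andbT.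
    apply/negP=> lw; move: le_v; rewrite -(eq_point w0 wv) card_light // leqNgt.
    by rewrite -{1}(expn1 q) ltn_exp2l ?q_gt1.
  rewrite sum_card_points //; last by rewrite !inE eqxx !andbF.
  by apply: subset_leq_card; apply/subsetP=> w /setIdP[].
- rewrite -cardD1 // /l -sum_nat_const.
  apply: (@leq_trans (\sum_(P in [set P in B | #|W :&: P| < q ^ 2]) #|(O :\ 0%R) :&: P|)%N).
    apply: leq_sum => P /setIdP[] /B_DP[k [k0 kC ->]]; rewrite ltnNge => nle.
    have kO : k \in O.
      by apply: contraNT nle => kO; rewrite card_heavy ?cone_heavy ?(subsetP cone_subW).
    rewrite -(card_line K k0) -cardD1 ?(subspace0 (sl k)) //; apply: subset_leq_card.
    rewrite setIDAC; apply: setSD; rewrite subsetI (sub_line sO kO) /=.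
    exact: sub_line (subspace_restrict K (subspace_point k)) (mem_point k).
  rewrite sum_card_points //; last by rewrite !inE eqxx.
  by apply: subset_leq_card; apply/subsetP=> w /setIdP[].
Qed.

(* If z were light, a hyperplane through z meeting W in rank 2 would contain a
   second light vector, since the point of a heavy one adds rank 2; the bound on
   light vectors leaves too few hyperplanes of this kind. *)
Lemma all_heavy z : z \in W -> z != 0 -> ~~ light z.
Proof.
move=> zW z0; apply/negP=> lz; have sW := subspace_W.
have lW : forall x, x \in W -> x \in point z -> x \in line_of K z.
  by move=> x xW xz; apply: (subsetP lz); rewrite inE xW.
pose S := Z :\: point z.
have leS : (#|S| <= 3 * Q)%N := leq_trans (subset_leq_card (subsetDl _ _)) card_light_vectors.
have E1 := sum_orth S z0; rewrite (_ : S :&: point z = set0) in E1; last first.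
  by apply/setP=> x; rewrite !inE; case: (x \in point z); rewrite ?andbF.
rewrite (_ : S :\: point z = S) ?cards0 ?mul0n ?add0n in E1; last first.
  by rewrite setDDl setUid.
have E2 := sum_orth_W z0; rewrite card_light // in E2.
have := light_estimate q_ge7 leqQ leqR leS E2; rewrite ltnNge => /negP[].
have R0 : (0 < R)%N := leq_trans (ltnW q_gt1) leqR.
have -> : (#|S| * R.-1 = \sum_(f : V | (f != 0%R) && orth f z) #|S :&: ker f|)%N.
  by apply/eqP; rewrite -(eqn_add2r #|S|) E1 addnC -mulnS prednK.
rewrite -cardQ -(sum_orth_const _ z0) big_distrr -big_split /=.
apply: leq_sum => f /andP[f0 fz].
have sf := ker_subspace K f0; have sWf := subspaceI sW sf.
have zD : z \in W :&: ker f by rewrite inE zW inE.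
have le2 := card_W_hyperplane (ker_hyperplane f0).
(* A light z' in ker f off the point of z brings its q - 1 nonzero K-multiples into [S :&: ker f],
   enough for the pointwise bound. *)
have [A0|[z']] := set_0Vmem (S :&: ker f); last first.
  move=> /setIP[/setDP[/setIdP[zW' /andP[z0' lz']] nz'] zf'].
  apply: light_pointwise_estimate le2.
  rewrite -(card_line K z0') (cardsD1 0) (subspace0 (sl z')) /=.
  apply: subset_leq_card; apply/subsetP=> x /setD1P[az0 /imsetP[a aK defx]].
  rewrite defx in az0 *; have a0 : a != 0 by apply: contraNneq az0 => ->; rewrite scale0r.
  have eqp : point (a *: z') = point z'.
    by apply: eq_point => //; apply/imsetP; exists a; rewrite ?in_setT.
  rewrite in_setI (subspaceZ sf) // andbT in_setD inE (subspaceZ sW) // az0 /=.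
  rewrite /light eqp line_scale // -/(light z') lz' andbT.
  by rewrite (subspaceZE (setT_closed F) _ (subspace_point z)) ?in_setT.
rewrite A0 cards0 muln0 add0n.
(* Without such a z', any w of the section off the K-line of z is heavy. Its point contributes rank
   at least 2 and misses z, so the section has rank at least 3. *)
have [w wD wl] : exists2 w, w \in W :&: ker f & w \notin line_of K z.
  apply/subsetPn; apply/negP=> /subset_leq_card; rewrite card_line // leqNgt => /negP; apply.
  by apply: leq_trans le2; rewrite -{1}(expn1 q) ltn_exp2l ?q_gt1.
have [wW wf] := setIP wD.
have w0 : w != 0 by apply: contraNneq wl => ->; apply: subspace0 (sl z).
have hw : ~~ light w.
  apply/negP=> lw; have : w \in S :&: ker f.
    rewrite in_setI wf andbT in_setD inE wW w0 lw /= andbT.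
    by apply: contra wl; apply: lW.
  by rewrite A0 inE.
have le_w := card_heavy wW hw.
have zw : z \notin W :&: point w.
  apply/negP=> /setIP[_ zw]; move: le_w; rewrite -(eq_point z0 zw) card_light // leqNgt.
  by rewrite -{1}(expn1 q) ltn_exp2l ?q_gt1.
have wWD : W :&: point w \subset W :&: ker f.
  by rewrite setIS // point_sub // (hyperplane_subspace (ker_hyperplane f0)).
have sWw := subspaceI sW (subspace_restrict K (subspace_point w)).
apply: leq_trans (card_lt_subspace K_field sWw sWf wWD zD zw).
by rewrite expnSr leq_mul2r le_w orbT.
Qed.

(** If a hyperplane through v meets W only inside the point of v, its point of B can be no other. If
    there is none, every hyperplane through v meets W in at least q times [#|W :&: point v|]
    vectors, against [tangent_estimate]. *)
Lemma point_in_B v : v \in W -> v != 0 -> point v \in B.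
Proof.
move=> vW v0; have sW := subspace_W; have sv := subspace_restrict K (subspace_point v).
have [/existsP[f /and3P[f0 fv sub]]|none] :=
  boolP [exists f : V, [&& f != 0, orth f v & W :&: ker f \subset point v]].
  have [P PB Pf] := blocking_meet bB (ker_hyperplane f0).
  have /B_DP[k [k0 kC defP]] := PB.
  have kf : k \in ker f by apply: (subsetP Pf); rewrite defP mem_point.
  suff -> : point v = P by [].
  rewrite defP -(eq_point k0) //; apply: (subsetP sub).
  by rewrite inE kf (subsetP cone_subW).
have le2 := card_heavy vW (all_heavy vW v0).
have E := sum_orth_W v0.
have := tangent_estimate q_ge7 leqQ leqR le2 E; rewrite ltnNge => /negP[].
rewrite -cardQ -(sum_orth_const _ v0); apply: leq_sum => f /andP[f0 fv].
have [u uD uv] : exists2 u, u \in W :&: ker f & u \notin point v.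
  by apply/subsetPn; apply: contra none => sub; apply/existsP; exists f; rewrite f0 fv.
have sf := ker_subspace K f0.
apply: (card_lt_subspace K_field (subspaceI sW sv) (subspaceI sW sf) _ uD).
  rewrite setIS // point_sub; last exact: hyperplane_subspace (ker_hyperplane f0).
  by rewrite inE.
by rewrite inE negb_and uv orbT.
Qed.

Lemma dvdn_card_subspace (U : {set V}) : is_subspace K U -> (q ^ 2 <= #|U|)%N -> (q ^ 2 %| #|U|)%N.
Proof.
move=> sU; have [k ->] := card_subspace K_field sU.
by rewrite leq_exp2l ?q_gt1 // => le2k; apply: dvdn_exp2l.
Qed.

(** By [point_in_B] the points of T partition X, so |X| + |T| is the sum of [#|W :&: P|] over P in
    T, a multiple of q^2. So is |X| + 1, the size of [W :&: H]; subtraction gives the congruence. *)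
Lemma hyperplane_mod_square (H : {set V}) : is_hyperplane H ->
  (#|[set P in B | P \subset H]| = 1 %[mod q ^ 2])%N.
Proof.
move=> hH; set T := [set P in B | _]; set X := (W :&: H) :\ 0.
have sH := hyperplane_subspace hH; have sW := subspace_W.
have X0 : 0 \notin X by rewrite !inE eqxx.
have ptT : {in T, forall P, exists2 v, v != 0 & P = point v} by move=> P /setIdP[/points_B].
have cX : #|X|.+1 = #|W :&: H|.
  by rewrite (cardsD1 0 (W :&: H)) inE (subspace0 sW) (subspace0 sH).
have E := sum_card_points ptT X0.
have defX : [set v in X | point v \in T] = X.
  apply/setP=> v; rewrite inE; case vX: (v \in X) => //=.
  case/setD1P: vX => v0 /setIP[vW vH].
  by rewrite inE point_in_B // point_sub.
rewrite defX in E.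
have dvX : (q ^ 2 %| #|X| + 1)%N.
  rewrite addn1 cX dvdn_card_subspace ?card_W_hyperplane //.
  by apply: subspaceI => //; apply: subspace_restrict.
have dvT : (q ^ 2 %| #|X| + #|T|)%N.
  rewrite -E -[#|T|]sum1_card -big_split /=; apply: dvdn_sum => P /setIdP[PB PH].
  have [v v0 defP] := points_B PB.
  have /B_DP[k [k0 kC defP']] := PB.
  have -> : (#|X :&: P| + 1 = #|W :&: P|)%N.
    have P0 : 0 \in P by rewrite defP (subspace0 (subspace_point v)).
    rewrite (cardsD1 0 (W :&: P)) inE (subspace0 sW) P0 addnC; congr (_ + _)%N.
    congr #|pred_of_set _|; apply/setP=> x; rewrite !inE.
    by case xP: (x \in P); rewrite ?andbF // (subsetP PH x xP) !andbT.
  have kW : k \in W := subsetP cone_subW k kC.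
  rewrite defP' dvdn_card_subspace ?card_heavy ?all_heavy //.
  by apply: subspaceI => //; apply: subspace_restrict (subspace_point k).
by apply/eqP; rewrite -(eqn_modDl #|X|) (eqP dvT) (eqP dvX).
Qed.

End ConeHeavy.

End ConeToLinear.

(** * The equivalence *)

Theorem theorem5p12 (p h t n e : nat) (F : finFieldType)
  (Hp : prime p) (Hp7 : (7 <= p)%N) (Hh : (0 < h)%N) (Ht : (0 < t)%N)
  (Hn : (3 <= n)%N) (HF : #|F| = ((p ^ h) ^ t)%N)
  (B : {set {set 'rV[F]_n}})
  (Hmin : minimal_blocking_hyp B) (Hsmall : small_set B)
  (He : is_exponent p B e) (He0 : (0 < e)%N) (Hediv : (e %| h * t)%N) :
  let q0 := (p ^ e)%N in
  let t0 := (h * t %/ e)%N in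
  let F0 := subfield_of F p e in
  (exists (Omega Gamma : {set 'rV[F]_n}) (Bbar : {set {set 'rV[F]_n}}),
      is_subspace F0 Omega /\ #|Omega| = (q0 ^ (t0 - 1))%N /\
      is_subspace F0 Gamma /\ #|Gamma| = (q0 ^ 3)%N /\
      Omega :&: Gamma = [set 0] /\
      plane_blocking F0 q0 Gamma Bbar /\ B = B_D (cone Omega Bbar))
  <-> is_linear p e B.
Proof.
move=> q0 t0 F0.
have cardF : #|F| = (q0 ^ t0)%N by rewrite HF /q0 /t0 -!expnM [(e * _)%N]mulnC divnK.
have t0_gt0 : (0 < t0)%N by rewrite divn_gt0 // dvdn_leq // muln_gt0 Hh.
have F0_field : divring_closed F0 := subfield_of_closed Hp cardF.
have cardF0 : #|F0| = q0 := card_subfield_of Hp He0 cardF.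
split; last first.
  move=> [mu [smu defB]]; rewrite -cardF0.
  by apply: (cone_of_linear F0_field Hn t0_gt0 _ Hmin smu defB); rewrite cardF0.
move=> [O [G [Bbar [sO [cO [sG [cG [OG [pbB defB]]]]]]]]].
rewrite -cardF0 in cO cG pbB.
have q_ge7 : (7 <= #|F0|)%N.
  by rewrite cardF0 (leq_trans Hp7) // -{1}(expn1 p) leq_exp2l // prime_gt1.
have cOq : (#|O| * #|F0| = #|F|)%N by rewrite cO -expnSr subn1 prednK // cardF cardF0.
have mB : minimal_blocking_hyp (B_D (cone O Bbar)) by rewrite -defB.
have [/existsP[L /and4P[sL LG /eqP cL /forall_inP full]]|none] :=
  boolP [exists L : {set 'rV[F]_n}, [&& is_subspace F0 L, L \subset G, #|L| == (#|F0| ^ 2)%N &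
    [forall c in L, (c != 0) ==> on_base F0 G Bbar c]]].
  exists (setsum O L); split; first exact: subspace_setsum.
  rewrite defB; apply: (linear_of_full_line F0_field Hn sO sG cOq cG OG pbB mB sL LG cL).
  by move=> c cL' c0; apply: implyP (full c cL') c0.
have no_full L : is_subspace F0 L -> L \subset G -> #|L| = (#|F0| ^ 2)%N ->
    exists c, [/\ c \in L, c != 0 & ~~ on_base F0 G Bbar c].
  move=> sL LG cL; have: ~~ [forall c in L, (c != 0) ==> on_base F0 G Bbar c].
    by apply: contra none => full; apply/existsP; exists L; rewrite sL LG cL eqxx.
  by case/forall_inPn=> c cL'; rewrite negb_imply => /andP[c0 nb]; exists c.
have bB : blocking_hyp (B_D (cone O Bbar)) by case/andP: mB.
have [/forallP modB maxe] := He.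
have modB' H : is_hyperplane H ->
    (#|[set P in B_D (cone O Bbar) | P \subset H]| = 1 %[mod #|F0|])%N.
  by move=> hH; apply/eqP; rewrite -defB cardF0; apply: implyP (modB H) hH.
(* Without a full line the situation is contradictory: congruences modulo q^2 = p^(2e) would force
   2e <= e. *)
suff /maxe : hyp_mod p B (e * 2) by rewrite leqNgt ltn_Pmulr.
apply/forallP=> H; apply/implyP=> hH; rewrite expnM -/q0 -cardF0 defB; apply/eqP.
apply: (hyperplane_mod_square F0_field q_ge7 Hn sO sG cOq cG OG pbB bB) hH.
exact: (cone_not_light F0_field q_ge7 Hn sO sG cOq cG OG pbB no_full modB').
Qed.
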